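(* Problem (M-SLQ-r) is equivalent to Problem (M-SLQ)$_r$ in the sense that the following hold: (i) For any $(x,i)\in\mathbb R^n\times\mathcal S$, $u_r^*(\cdot;x,i)$ is an open-loop optimal control for Problem (M-SLQ)$_r$ at $(x,i)$ if and only if $\{u^*(t)=e^{\frac r2t}u_r^*(t;x,i)\mid t\ge0\}$ is an open-loop optimal control for Problem (M-SLQ-r) at $(x,i)$. (ii) A pair $(\widehat{\mathbf\Theta}_r,\widehat\nu_r(\cdot))$ is a closed-loop optimal strategy of Problem (M-SLQ)$_r$ if and only if $\big(\widehat{\mathbf\Theta}_r,\{\widehat\nu(t)=e^{\frac r2t}\widehat\nu_r(t)\mid t\ge0\}\big)$ is a closed-loop optimal strategy of Problem (M-SLQ-r).
   Context: $(\Omega,\mathcal F,\mathbb P)$ is a complete probability space with the natural filtration $\mathbb F$ generated by a standard one-dimensional Brownian motion $W$ and a continuous-time irreducible Markov chain $\alpha$ with finite state space $\mathcal S=\{1,\dots,L\}$; stochastic integrals against $dW$ are Itô integrals with respect to $\mathbb F$. $L^2_{\mathbb F}(\mathbb H)$: $\mathbb F$-progressively measurable $\mathbb H$-valued processes on $[0,\infty)$ with $\mathbb E\int_0^\infty|\varphi|^2dt<\infty$. $\mathcal D(\mathbb B)$: $L$-tuples of elements of $\mathbb B$. Data: $r>0$; for $i\in\mathcal S$, $A(i),C(i)\in\mathbb R^{n\times n}$, $B(i),D(i)\in\mathbb R^{n\times m}$, symmetric $Q(i)\in\mathbb R^{n\times n}$, $R(i)\in\mathbb R^{m\times m}$, and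 $S(i)\in\mathbb R^{m\times n}$; $b,\sigma,q\in L^2_{\mathbb F}(\mathbb R^n)$, $\rho\in L^2_{\mathbb F}(\mathbb R^m)$. Put $A_r(i)=A(i)-\frac r2I$, and $b_r(t)=e^{-\frac r2t}b(t)$, $\sigma_r(t)=e^{-\frac r2t}\sigma(t)$, $q_r(t)=e^{-\frac r2t}q(t)$, $\rho_r(t)=e^{-\frac r2t}\rho(t)$. Problem (M-SLQ-r): the state $X$ solves $dX=[A(\alpha)X+B(\alpha)u+b]dt+[C(\alpha)X+D(\alpha)u+\sigma]dW$, $X(0)=x$, $\alpha_0=i$; minimize $$J_r(x,i;u)=\mathbb E\int_0^\infty e^{-rt}[\langle Q(\alpha)X,X\rangle+2\langle S(\alpha)X,u\rangle+\langle R(\alpha)u,u\rangle+2\langle q,X\rangle+2\langle\rho,u\rangle]dt$$ over progressively measurable $u$ such that $e^{-\frac r2t}u\in L^2_{\mathbb F}(\mathbb R^m)$ and $e^{-\frac r2t}X\in L^2_{\mathbb F}(\mathbb R^n)$. Problem (M-SLQ)$_r$: the state $X_r$ solves $dX_r=[A_r(\alpha)X_r+B(\alpha)u_r+b_r]dt+[C(\alpha)X_r+D(\alpha)u_r+\sigma_r]dW$, $X_r(0)=x$, $\alpha_0=i$; minimize $$\mathbb E\int_0^\infty[\langle Q(\alpha)X_r,X_r\rangle+2\langle S(\alpha)X_r,u_r\rangle+\langle R(\alpha)u_r,u_r\rangle+2\langle q_r,X_r\rangle+2\langle\rho_r,u_r\rangle]dt$$ over $u_r\in L^2_{\mathbb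 F}(\mathbb R^m)$ with $X_r\in L^2_{\mathbb F}(\mathbb R^n)$. In each problem, an open-loop optimal control at $(x,i)$ is an admissible control attaining the minimum over all admissible controls at $(x,i)$. A closed-loop strategy of Problem (M-SLQ)$_r$ is a pair $(\mathbf\Theta,\nu)\in\mathcal D(\mathbb R^{m\times n})\times L^2_{\mathbb F}(\mathbb R^m)$ such that for every $(x,i)$ the state obtained by substituting $u_r=\Theta(\alpha)X_r+\nu$ is in $L^2_{\mathbb F}(\mathbb R^n)$; for Problem (M-SLQ-r) it is a pair $(\mathbf\Theta,\nu)$ with $e^{-\frac r2t}\nu\in L^2_{\mathbb F}(\mathbb R^m)$ such that for every $(x,i)$ the state obtained by substituting $u=\Theta(\alpha)X+\nu$ satisfies $e^{-\frac r2t}X\in L^2_{\mathbb F}(\mathbb R^n)$. A closed-loop strategy is closed-loop optimal if for every $(x,i)$ the resulting control $\Theta(\alpha)X+\nu$ (its outcome) is an open-loop optimal control at $(x,i)$. *)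

(* Defs.v *)
From HB Require Import structures.
From mathcomp Require Import all_boot all_order all_algebra.
From mathcomp Require Import all_classical all_reals all_analysis.

Set Implicit Arguments.
Unset Strict Implicit.
Unset Printing Implicit Defensive.

Import Order.TTheory GRing.Theory Num.Theory.
Import numFieldNormedType.Exports.

Local Open Scope classical_set_scope.
Local Open Scope ring_scope.

(* Processes are indexed by the whole of R, but only the times t >= 0 are ever
   looked at.  Vector-valued processes are treated entrywise. *)

Section Processes.
Context {d : measure_display} {Omega : measurableType d} {R : realType}.

Definition process (n : nat) : Type := R -> Omega -> 'cV[R]_n.

Definition entry n (X : process n) (j : 'I_n) : R -> Omega -> R :=
  fun t w => X t w j 0.

Definition inner n (v w : 'cV[R]_n) : R := (v^T *m w) 0 0.

(* t |-> e^(c t) X(t) *)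
Definition exp_weight (c : R) n (X : process n) : process n :=
  fun t w => expR (c * t) *: X t w.

Definition progressive (F : R -> set (set Omega)) (f : R -> Omega -> R) :=
  forall t, 0 <= t ->
    measurable_fun (`[0%R, t]%classic `*` [set: g_sigma_algebraType (F t)])
      (fun z : R * g_sigma_algebraType (F t) => f z.1 z.2).

Definition L2F (F : R -> set (set Omega)) (Q : probability Omega R) n
    (X : process n) :=
  (forall j, progressive F (entry X j)) /\
  (\int[Q]_w \int[lebesgue_measure]_(t in `[0%R, +oo[%classic)
     (inner (X t w) (X t w))%:E < +oo)%E.

Definition continuous_paths (f : R -> Omega -> R) :=
  forall w, {within `[0%R, +oo[%classic, continuous (f ^~ w)}.

End Processes.

Section Noise.
Context {d : measure_display} {Omega : measurableType d} {R : realType}.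

Record noise (L : nat) := Noise {
  bm : R -> Omega -> R;
  regime : R -> Omega -> 'I_L;
  regime_measurable : forall t i, measurable (regime t @^-1` [set i]) }.

(* Generated by the Brownian motion and the chain, augmented by the null sets *)
Definition natural_filtration (P : probability Omega R) L (N : noise L)
    (t : R) : set (set Omega) :=
  <<s [set A | [\/ exists s (B : set R),
                     [/\ 0 <= s, s <= t, measurable B & A = bm N s @^-1` B],
                   exists s i, [/\ 0 <= s, s <= t &
                                 A = regime N s @^-1` [set i]]
                 | measurable A /\ P A = 0%E] ]>>.

Definition brownian_motion (P : probability Omega R)
    (F : R -> set (set Omega)) (W : R -> Omega -> R) :=
  [/\ (forall w, W 0 w = 0),
      continuous_paths W,
      (forall t, 0 <= t -> measurable_fun [set: Omega] (W t)) &
      forall s t A (B : set R), 0 <= s -> s < t -> F s A -> measurable B ->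
        P (A `&` [set w | B (W t w - W s w)]) =
        (P A * normal_prob 0 (Num.sqrt (t - s)) B)%E].

(* p t i j is the probability of moving from i to j in time t *)
Definition transition_semigroup L (p : R -> 'M[R]_L) :=
  [/\ (forall t i j, 0 <= t -> 0 <= p t i j),
      (forall t i, 0 <= t -> \sum_j p t i j = 1),
      p 0 = 1%:M,
      (forall s t, 0 <= s -> 0 <= t -> p (s + t) = p s *m p t) &
      forall i j, p t i j @[t --> 0^'+] --> p 0 i j].

Definition irreducible_markov_chain (P : probability Omega R) L
    (alpha : R -> Omega -> 'I_L) :=
  (forall w t, 0 <= t -> \forall s \near t^'+, alpha s w = alpha t w) /\
  exists p : R -> 'M[R]_L,
    [/\ transition_semigroup p,
        (forall i j, exists2 t, 0 < t & 0 < p t i j) &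
        forall (t : nat -> R) (i : nat -> 'I_L) (k : nat), 0 <= t 0%N ->
          (forall l, t l < t l.+1) ->
          P [set w | forall l, (l <= k.+1)%N -> alpha (t l) w = i l] =
          (P [set w | forall l, (l <= k)%N -> alpha (t l) w = i l] *
           (p (t k.+1 - t k) (i k) (i k.+1))%:E)%E].

(* The law P( . | alpha_0 = i), under which problems started at regime i are
   posed; mnormalize is the genuine conditional probability as soon as
   P(alpha_0 = i) > 0. *)
Definition start_law (P : probability Omega R) L (N : noise L) (i : 'I_L) :
    probability Omega R :=
  mnormalize (mrestr P (regime_measurable N 0 i)) P.

End Noise.

Section Ito.
Context {d : measure_display} {Omega : measurableType d} {R : realType}.
Variable F : R -> set (set Omega).

(* \sum_k coef_k 1_(time_k, time_(k+1)], coef_k bounded and F_(time_k)-measurable *)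
Record simple_process := SimpleProcess {
  sp_size : nat;
  sp_time : nat -> R;
  sp_coef : nat -> Omega -> R;
  sp_time_ge0 : 0 <= sp_time 0%N;
  sp_time_mono : forall k, sp_time k <= sp_time k.+1;
  sp_coef_measurable : forall k,
    measurable_fun [set: g_sigma_algebraType (F (sp_time k))]
      (sp_coef k : g_sigma_algebraType (F (sp_time k)) -> R);
  sp_coef_bounded : forall k, exists M, forall w, `|sp_coef k w| <= M }.

Definition sp_val (H : simple_process) (t : R) (w : Omega) : R :=
  \sum_(k < sp_size H)
    sp_coef H k w * ((sp_time H k < t <= sp_time H k.+1)%R)%:R.

Definition sp_int (W : R -> Omega -> R) (H : simple_process) (t : R)
    (w : Omega) : R :=
  \sum_(k < sp_size H) sp_coef H k w *
    (W (Num.min t (sp_time H k.+1)) w - W (Num.min t (sp_time H k)) w).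

(* I is (a continuous version of) the Ito integral process of phi against W,
   under Q: the limit, uniformly on compacts in Q-probability, of the
   integrals of simple processes approximating phi. *)
Definition ito_integral (Q : probability Omega R) (W phi I : R -> Omega -> R) :=
  [/\ progressive F phi,
      {ae Q, forall w, forall T : R, 0 <= T ->
        (\int[lebesgue_measure]_(t in `[0%R, T]%classic)
           (phi t w ^+ 2)%:E < +oo)%E},
      continuous_paths I &
      exists H : nat -> simple_process, forall T e : R, 0 <= T -> 0 < e ->
        (fun k => Q [set w |
           (e%:E < \int[lebesgue_measure]_(t in `[0%R, T]%classic)
                     ((sp_val (H k) t w - phi t w) ^+ 2)%:E)%E])
          @ \oo --> 0%E /\
        (fun k => Q [set w | exists t,
           0 <= t <= T /\ e < `|sp_int W (H k) t w - I t w|])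
          @ \oo --> 0%E].

End Ito.

Section SLQ.
Context {d : measure_display} {Omega : measurableType d} {R : realType}.
Variables (P : probability Omega R) (L n m : nat) (N : @noise d Omega R L).

Record slq_data := SLQData {
  cA : 'I_L -> 'M[R]_n;
  cB : 'I_L -> 'M[R]_(n, m);
  cC : 'I_L -> 'M[R]_n;
  cD : 'I_L -> 'M[R]_(n, m);
  cQ : 'I_L -> 'M[R]_n;
  cS : 'I_L -> 'M[R]_(m, n);
  cR : 'I_L -> 'M[R]_m;
  fb : @process d Omega R n;
  fsigma : @process d Omega R n;
  fq : @process d Omega R n;
  frho : @process d Omega R m }.

Local Notation F := (natural_filtration P N).
Local Notation Plaw := (start_law P N).

Definition drift (D : slq_data) (X : process n) (u : process m) : process n :=
  fun t w => cA D (regime N t w) *m X t w + cB D (regime N t w) *m u t w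
             + fb D t w.

Definition diffusion (D : slq_data) (X : process n) (u : process m) :
    process n :=
  fun t w => cC D (regime N t w) *m X t w + cD D (regime N t w) *m u t w
             + fsigma D t w.

(* X is the state with initial condition (x, i) under the control u *)
Definition state (D : slq_data) (x : 'cV[R]_n) (i : 'I_L)
    (u : process m) (X : process n) :=
  [/\ (forall j, progressive F (entry X j)),
      (forall j, continuous_paths (entry X j)),
      (forall j, {ae Plaw i, forall w, forall T : R, 0 <= T ->
         lebesgue_measure.-integrable `[0%R, T]%classic
           (EFin \o (fun t => entry (drift D X u) j t w))}) &
      exists I : process n,
        (forall j, ito_integral F (Plaw i) (bm N)
           (entry (diffusion D X u) j) (entry I j)) /\
        (forall j, {ae Plaw i, forall w, forall t : R, 0 <= t ->
           entry X j t w =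
             x j 0
             + \int[lebesgue_measure]_(s in `[0%R, t]%classic)
                 entry (drift D X u) j s w
             + entry I j t w})].

Definition running_cost (D : slq_data) (X : process n) (u : process m)
    (t : R) (w : Omega) : R :=
  let a := regime N t w in
  inner (cQ D a *m X t w) (X t w) + 2 * inner (cS D a *m X t w) (u t w)
  + inner (cR D a *m u t w) (u t w)
  + 2 * inner (fq D t w) (X t w) + 2 * inner (frho D t w) (u t w).

Definition feedback (Theta : 'I_L -> 'M[R]_(m, n)) (nu : process m)
    (X : process n) : process m :=
  fun t w => Theta (regime N t w) *m X t w + nu t w.

(* Problem (M-SLQ-r): discounted cost *)

Definition disc_admissible (r : R) D x i (u : process m) (X : process n) :=
  [/\ state D x i u X, L2F F (Plaw i) (exp_weight (- (r / 2)) u)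
    & L2F F (Plaw i) (exp_weight (- (r / 2)) X)].

Definition disc_cost (r : R) D (i : 'I_L) (u : process m) (X : process n) :
    \bar R :=
  (\int[Plaw i]_w \int[lebesgue_measure]_(t in `[0%R, +oo[%classic)
     (expR (- (r * t)) * running_cost D X u t w)%:E)%E.

Definition disc_open_loop_optimal (r : R) D x i (u : process m) :=
  exists2 X, disc_admissible r D x i u X &
    forall v Y, disc_admissible r D x i v Y ->
      (disc_cost r D i u X <= disc_cost r D i v Y)%E.

Definition disc_closed_loop_strategy (r : R) D Theta (nu : process m) :=
  L2F F P (exp_weight (- (r / 2)) nu) /\
  forall x i, exists2 X, state D x i (feedback Theta nu X) X &
    L2F F (Plaw i) (exp_weight (- (r / 2)) X).

Definition disc_closed_loop_optimal (r : R) D Theta (nu : process m) :=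
  disc_closed_loop_strategy r D Theta nu /\
  forall x i X, state D x i (feedback Theta nu X) X ->
    disc_open_loop_optimal r D x i (feedback Theta nu X).

(* Undiscounted problem *)

Definition admissible D x i (u : process m) (X : process n) :=
  [/\ state D x i u X, L2F F (Plaw i) u & L2F F (Plaw i) X].

Definition cost D (i : 'I_L) (u : process m) (X : process n) : \bar R :=
  (\int[Plaw i]_w \int[lebesgue_measure]_(t in `[0%R, +oo[%classic)
     (running_cost D X u t w)%:E)%E.

Definition open_loop_optimal D x i (u : process m) :=
  exists2 X, admissible D x i u X &
    forall v Y, admissible D x i v Y -> (cost D i u X <= cost D i v Y)%E.

Definition closed_loop_strategy D Theta (nu : process m) :=
  L2F F P nu /\
  forall x i, exists2 X, state D x i (feedback Theta nu X) X & L2F F (Plaw i) X.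

Definition closed_loop_optimal D Theta (nu : process m) :=
  closed_loop_strategy D Theta nu /\
  forall x i X, state D x i (feedback Theta nu X) X ->
    open_loop_optimal D x i (feedback Theta nu X).

(* Problem (M-SLQ)_r is the undiscounted problem for these data *)
Definition shifted_data (r : R) (D : slq_data) : slq_data := {|
  cA := fun i => cA D i - (r / 2)%:M;
  cB := cB D;
  cC := cC D;
  cD := cD D;
  cQ := cQ D;
  cS := cS D;
  cR := cR D;
  fb := exp_weight (- (r / 2)) (fb D);
  fsigma := exp_weight (- (r / 2)) (fsigma D);
  fq := exp_weight (- (r / 2)) (fq D);
  frho := exp_weight (- (r / 2)) (frho D) |}.

End SLQ.

(* Main.v *)
Require Import Defs.
From HB Require Import structures.
From mathcomp Require Import all_boot all_order all_algebra.
From mathcomp Require Import all_classical all_reals all_analysis.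
From mathcomp Require Import measurable_realfun.
From mathcomp Require Import ring lra.

Set Implicit Arguments.
Unset Strict Implicit.
Unset Printing Implicit Defensive.

Import Order.TTheory GRing.Theory Num.Theory.
Import numFieldNormedType.Exports.

Local Open Scope classical_set_scope.
Local Open Scope ring_scope.

(* Put c = -r/2. The map (X, u) |-> (e^(c t) X, e^(c t) u) identifies the
   admissible pairs of the two problems and the integrands of their costs, so
   everything rests on the product rule for e^(c t) X when X solves the state
   equation. Pathwise integration by parts shows that the integral of
   e^(c s) phi(s) against W has to be
     e^(c t) I(t) - c \int_0^t e^(c s) I(s) ds,   I = \int phi dW,
   and one must check that this process is a limit of simple integrals.
   If simple H_k approximate phi, subdivide the intervals of H_k and freeze
   e^(c t) at left endpoints: the new simple integral misses the displayed
   transform of \int H_k dW by a multiple of the modulus of continuity of W at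
   the mesh, which is small off an event of small probability, while the
   transform is Lipschitz for uniform convergence on compacts.
   Probabilities of non-measurable sets being arbitrary, monotonicity of P may
   only be used after the events have been shown measurable: paths are
   continuous, and I is almost surely X - x - \int drift, where the drift is
   jointly measurable because the chain has right-continuous paths. *)

(** * Pathwise integration by parts against an exponential *)

Section ExpConv.
Context {R : realType}.
Local Notation mu := (@lebesgue_measure R).
Implicit Types (f g h : R -> R) (c s t u v : R).

(* The pathwise value of \int_0^t e^(c s) dh(s), obtained by integrating by
   parts; it makes sense without bounded variation of h. *)
Definition exp_conv c h t :=
  expR (c * t) * h t - c * \int[mu]_(s in `[0%R, t]) (expR (c * s) * h s).

Lemma within_continuous_expM (A : set R) c h :
  {within A, continuous h} ->
  {within A, continuous (fun s => expR (c * s) * h s)}.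
Proof.
move=> /subspace_continuousP hc; apply/subspace_continuousP => x Ax.
apply: cvgM; last exact: hc.
apply: cvg_within_filter.
apply: (@continuous_comp _ _ _ ( *%R c) expR); last exact: continuous_expR.
exact: mulrl_continuous.
Qed.

Lemma within_itv_integrable h u v :
  {within `[u, v], continuous h} -> mu.-integrable `[u, v] (EFin \o h).
Proof.
by move=> hc; apply: continuous_compact_integrable => //; exact: segment_compact.
Qed.

Lemma within_ray_itv h u v : 0 <= u ->
  {within `[0%R, +oo[, continuous h} -> {within `[u, v], continuous h}.
Proof.
move=> u0; apply: continuous_subspaceW => x /=.
by rewrite !in_itv/= andbT => /andP[ux _]; exact: le_trans ux.
Qed.

Lemma within_ray_integrable h u v : 0 <= u ->
  {within `[0%R, +oo[, continuous h} -> mu.-integrable `[u, v] (EFin \o h).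
Proof. by move=> u0 hc; apply: within_itv_integrable; exact: within_ray_itv. Qed.

Lemma integrable_itvS h a b u v : a <= u -> v <= b ->
  mu.-integrable `[a, b] (EFin \o h) -> mu.-integrable `[u, v] (EFin \o h).
Proof.
move=> au vb; apply: integrableS => //; apply: subset_itv; by rewrite bnd_simp.
Qed.

Lemma Rintegral_itv_split h a u v : a <= u -> u <= v ->
  mu.-integrable `[a, v] (EFin \o h) ->
  \int[mu]_(s in `[a, v]) h s =
  \int[mu]_(s in `[a, u]) h s + \int[mu]_(s in `[u, v]) h s.
Proof.
move=> au uv hi; apply/eqP; rewrite addrC -subr_eq; apply/eqP.
rewrite Rintegral_itvB ?bnd_simp//.
apply: Rintegral_itv_obnd_cbnd.
apply: integrableS hi => //; apply: subset_itv; by rewrite bnd_simp.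
Qed.

Lemma fine_lebesgue_itv u v : u <= v -> fine (mu `[u, v]) = v - u.
Proof.
move=> uv; rewrite lebesgue_measure_itv/= lte_fin.
by move: uv; rewrite le_eqVlt => /predU1P[->|->//]; rewrite ltxx subrr.
Qed.

Lemma continuous_exp_scale c : continuous (fun s : R => expR (c * s)).
Proof.
move=> x; apply: (@continuous_comp _ _ _ ( *%R c) expR).
  exact: mulrl_continuous.
exact: continuous_expR.
Qed.

Lemma exp_scale_integrable c u v :
  mu.-integrable `[u, v] (EFin \o (fun s => expR (c * s))).
Proof.
by apply: within_itv_integrable; apply: continuous_subspaceT;
   exact: continuous_exp_scale.
Qed.

(** The factor [c] is kept on the left instead of dividing by it, so that [c = 0] is covered as
    well. *)
Lemma Rintegral_exp_scale c u v : u <= v ->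
  c * \int[mu]_(s in `[u, v]) expR (c * s) = expR (c * v) - expR (c * u).
Proof.
rewrite le_eqVlt => /predU1P[->|uv].
  by rewrite set_itv1 Rintegral_set1 mulr0 subrr.
rewrite -RintegralZl//; last exact: exp_scale_integrable.
have dE (x : R) : is_derive x 1 (fun s : R => expR (c * s)) (c * expR (c * x)).
  have := is_derive1_comp (is_derive_expR (c * x)) (is_deriveZ c (is_derive_id x 1)).
  by rewrite /= /GRing.scale/= mulr1 mulrC.
rewrite /Rintegral (@continuous_FTC2 _ _ (fun s : R => expR (c * s)) _ _ uv)//.
- apply: continuous_subspaceT => x; apply: cvgM; first exact: cvg_cst.
  exact: continuous_exp_scale.
- split.
  + by move=> x _; apply: (@ex_derive _ _ _ _ _ _ _ (dE x)).
  + by apply: cvg_at_right_filter; exact: continuous_exp_scale.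
  + by apply: cvg_at_left_filter; exact: continuous_exp_scale.
- by move=> x _; rewrite derive1E derive_val.
Qed.

End ExpConv.

(** * Size, stability and continuity of the exponential transform *)

Section ExpConvBounds.
Context {R : realType}.
Local Notation mu := (@lebesgue_measure R).
Implicit Types (f g h : R -> R) (c s t u v : R).

Lemma integrable_EFinD f g (D : set R) : measurable D ->
  mu.-integrable D (EFin \o f) -> mu.-integrable D (EFin \o g) ->
  mu.-integrable D (EFin \o (fun s => f s + g s)).
Proof. by move=> mD fi gi; have := @integrableD _ _ _ mu D mD (EFin \o f) (EFin \o g) fi gi. Qed.

Lemma integrable_EFinB f g (D : set R) : measurable D ->
  mu.-integrable D (EFin \o f) -> mu.-integrable D (EFin \o g) ->
  mu.-integrable D (EFin \o (fun s => f s - g s)).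
Proof. by move=> mD fi gi; have := @integrableB _ _ _ mu D mD (EFin \o f) (EFin \o g) fi gi. Qed.

Lemma integrable_EFinZl k f (D : set R) : measurable D ->
  mu.-integrable D (EFin \o f) ->
  mu.-integrable D (EFin \o (fun s => k * f s)).
Proof.
by move=> mD fi; have := @integrableZl _ _ _ mu D mD k (EFin \o f) fi.
Qed.

Lemma normr_Rintegral_itv_le f u v M : u <= v ->
  mu.-integrable `[u, v] (EFin \o f) ->
  (forall s, u <= s <= v -> `|f s| <= M) ->
  `|\int[mu]_(s in `[u, v]) f s| <= M * (v - u).
Proof.
move=> uv fi fM; apply: (le_trans (le_normr_Rintegral _ fi)) => //.
rewrite -(fine_lebesgue_itv uv) -Rintegral_cst//.
have Mi : mu.-integrable `[u, v] (EFin \o (fun=> M)).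
  apply: within_itv_integrable; apply: continuous_subspaceT => x; exact: cvg_cst.
by apply: le_Rintegral => //; exact: integrable_norm.
Qed.

Lemma exp_scale_le c s T : 0 <= s <= T -> expR (c * s) <= expR (`|c| * T).
Proof.
move=> /andP[s0 sT]; rewrite ler_expR (le_trans (ler_norm _))// normrM.
by rewrite (ger0_norm s0) ler_wpM2l.
Qed.

Lemma exp_scale_lipschitz c u v T : 0 <= u -> u <= v -> v <= T ->
  `|expR (c * v) - expR (c * u)| <= `|c| * expR (`|c| * T) * (v - u).
Proof.
move=> u0 uv vT; rewrite -Rintegral_exp_scale// normrM -mulrA ler_wpM2l//.
apply: normr_Rintegral_itv_le => //; first exact: exp_scale_integrable.
move=> s /andP[us sv]; rewrite ger0_norm ?expR_ge0// exp_scale_le//.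
by rewrite (le_trans u0 us) (le_trans sv vT).
Qed.

(** The difference inside the norm equals c \int_u^v e^(c s) (h(v) - h(s)) ds, because e^(c v) -
    e^(c u) is itself c \int_u^v e^(c s) ds. Only the oscillation of [h] on [[u, v]] then
    matters. *)
Lemma exp_conv_incr c h u v T eta : 0 <= u -> u <= v -> v <= T ->
  {within `[0%R, +oo[, continuous h} ->
  (forall s, u <= s <= v -> `|h v - h s| <= eta) ->
  `|(exp_conv c h v - exp_conv c h u) - expR (c * u) * (h v - h u)| <=
    eta * (`|c| * expR (`|c| * T)) * (v - u).
Proof.
move=> u0 uv vT hc hosc.
have hi a b : 0 <= a ->
    mu.-integrable `[a, b] (EFin \o (fun s => expR (c * s) * h s)).
  by move=> a0; apply: within_ray_integrable => //; exact: within_continuous_expM.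
have ei : mu.-integrable `[u, v] (EFin \o (fun s => expR (c * s) * h v)).
  apply: within_itv_integrable; apply: continuous_subspaceT => x.
  apply: cvgM; last exact: cvg_cst.
  exact: continuous_exp_scale.
rewrite /exp_conv (Rintegral_itv_split u0 uv (hi _ _ (lexx 0))).
have -> : forall a b e d p q : R, a * p - c * (e + d) - (b * q - c * e) - b * (p - q)
    = (a - b) * p - c * d by move=> *; ring.
rewrite -Rintegral_exp_scale// -mulrA -RintegralZr//; last first.
  exact: exp_scale_integrable.
rewrite -mulrBr -RintegralB//; last exact: hi.
rewrite normrM -mulrA mulrCA -mulrA ler_wpM2l// mulrA.
apply: normr_Rintegral_itv_le => //.
  by apply: integrable_EFinB => //; exact: hi.
move=> s /andP[us sv]; rewrite -mulrBr normrM ger0_norm ?expR_ge0//.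
rewrite ler_pM ?expR_ge0//.
  by rewrite exp_scale_le// (le_trans u0 us) (le_trans sv vT).
by apply: hosc; rewrite us.
Qed.

(** The Lipschitz bound through which uniform convergence on compacts passes to the transforms: the
    boundary term contributes e^(|c| T), the integral |c| T e^(|c| T). *)
Lemma exp_conv_dist c f h t T eta : 0 <= t -> t <= T -> 0 <= eta ->
  {within `[0%R, +oo[, continuous f} -> {within `[0%R, +oo[, continuous h} ->
  (forall s, 0 <= s <= t -> `|f s - h s| <= eta) ->
  `|exp_conv c f t - exp_conv c h t| <=
    eta * (expR (`|c| * T) * (1 + `|c| * T)).
Proof.
move=> t0 tT eta0 fc hc fh.
have T0 : 0 <= T by apply: le_trans tT.
have hi g : {within `[0%R, +oo[, continuous g} ->
    mu.-integrable `[0%R, t] (EFin \o (fun s => expR (c * s) * g s)).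
  by move=> gc; apply: within_ray_integrable => //; exact: within_continuous_expM.
rewrite /exp_conv.
have -> : forall a b d p q : R, a * b - c * d - (a * p - c * q) =
    a * (b - p) - c * (d - q) by move=> *; ring.
rewrite -RintegralB//; [|exact: hi|exact: hi].
rewrite (_ : eta * _ = expR (`|c| * T) * eta + `|c| * (expR (`|c| * T) * eta * T));
  last by ring.
rewrite (le_trans (ler_normB _ _))// lerD//.
  rewrite normrM ler_pM ?fh ?t0 ?lexx//.
  by rewrite ger0_norm ?expR_ge0// exp_scale_le// t0.
rewrite normrM ler_wpM2l//.
have bd s : 0 <= s <= t ->
    `|expR (c * s) * f s - expR (c * s) * h s| <= expR (`|c| * T) * eta.
  move=> /andP[s0 st]; rewrite -mulrBr normrM ger0_norm ?expR_ge0//.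
  rewrite ler_pM ?expR_ge0//.
    by rewrite exp_scale_le// s0 (le_trans st tT).
  by apply: fh; rewrite s0.
apply: le_trans (normr_Rintegral_itv_le t0 _ bd) _.
  by apply: integrable_EFinB => //; exact: hi.
by rewrite subr0 ler_wpM2l// mulr_ge0 ?expR_ge0.
Qed.

(** Continuity is local: near [x], the points of the ray all lie in [[0, x + 1]]. Results on compact
    intervals thus extend to the ray. *)
Lemma within_ray_of_itv h :
  (forall b, 0 <= b -> {within `[0%R, b], continuous h}) ->
  {within `[0%R, +oo[, continuous h}.
Proof.
move=> hc; apply/subspace_continuousP => x /=; rewrite in_itv/= andbT => x0.
have x1 : x <= x + 1 by rewrite lerDl.
have xle : \forall y \near x, y <= x + 1.
  by have : x < x + 1 by [rewrite ltrDl]; move/lt_nbhsl; apply: filterS => y /ltW.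
have /subspace_continuousP/(_ x) := hc _ (le_trans x0 x1).
rewrite /= in_itv/= x0 x1 => /(_ isT).
apply: cvg_trans => P; rewrite /= !nbhs_simpl/= /within/= => PI.
near=> y => /=; rewrite in_itv/= andbT => y0.
have : y \in `[0%R, x + 1] -> P (h y) by near: y.
apply; rewrite in_itv/= y0/=; near: y.
exact: xle.
Unshelve. all: by end_near. Qed.

Lemma continuous_Rintegral_ray f :
  (forall b, 0 <= b -> mu.-integrable `[0%R, b] (EFin \o f)) ->
  {within `[0%R, +oo[, continuous (fun t => \int[mu]_(s in `[0%R, t]) f s)}.
Proof.
move=> fi; apply: within_ray_of_itv => b b0.
exact: parameterized_integral_continuous (fi _ b0).
Qed.

Lemma continuous_exp_conv c h : {within `[0%R, +oo[, continuous h} ->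
  {within `[0%R, +oo[, continuous (exp_conv c h)}.
Proof.
move=> hc; have ehc := within_continuous_expM (c:=c) hc.
have Ic : {within `[0%R, +oo[, continuous
    (fun t => \int[mu]_(s in `[0%R, t]) (expR (c * s) * h s))}.
  by apply: continuous_Rintegral_ray => b b0; exact: within_ray_integrable.
apply/subspace_continuousP => x x0; apply: cvgB.
  by move/subspace_continuousP : ehc; exact.
apply: cvgM; first exact: cvg_cst.
by move/subspace_continuousP : Ic; exact.
Qed.

End ExpConvBounds.

(** * The transform of an indefinite integral *)

Section ExpConvPrimitive.
Context {R : realType}.
Local Notation mu := (@lebesgue_measure R).

(** Cut [[0, t]] into K + 1 equal pieces: the bounds telescope in [A] to C t (A(t) - A(0)) / (K +
    1), which is as small as desired. *)
Lemma additive_increments_eq0 (G A : R -> R) (C t : R) : 0 <= t ->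
  (forall u v, 0 <= u -> u <= v -> v <= t ->
    `|G v - G u| <= C * (v - u) * (A v - A u)) ->
  G t = G 0.
Proof.
move=> t0 GA; apply/eqP; rewrite -subr_eq0 -normr_le0; apply/ler_addgt0Pr => e e0.
rewrite add0r.
have [K hK] : exists K : nat, C * t * (A t - A 0) / e < K.+1%:R.
  exists (Num.bound `|C * t * (A t - A 0) / e|).
  rewrite (le_lt_trans (ler_norm _))// (lt_trans (archi_boundP _))//.
  by rewrite ltr_nat.
pose s l : R := t * l%:R / K.+1%:R.
have K0 : 0 < K.+1%:R :> R by [].
have s0 : s 0%N = 0 by rewrite /s mulr0 mul0r.
have sK : s K.+1 = t by rewrite /s mulfK// gt_eqF.
have sge0 l : 0 <= s l by rewrite /s divr_ge0// mulr_ge0.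
have sS l : s l.+1 - s l = t / K.+1%:R.
  by rewrite /s -mulrBl -mulrBr -natrB// subSnn mulr1.
have sle l : s l <= s l.+1 by rewrite -subr_ge0 sS divr_ge0.
have smon : {homo s : i j / (i <= j)%N >-> i <= j}.
  by apply: homo_leq => //; exact: le_trans.
have -> : G t - G 0 = \sum_(0 <= l < K.+1) (G (s l.+1) - G (s l)).
  by rewrite (telescope_sumr (G \o s))//= sK s0.
apply: le_trans (ler_norm_sum _ _ _) _.
apply: (@le_trans _ _ (\sum_(0 <= l < K.+1) C * (t / K.+1%:R) * (A (s l.+1) - A (s l)))).
  rewrite !big_mkord; apply: ler_sum => l _.
  by rewrite -(sS l) GA// -sK smon.
rewrite -mulr_sumr (telescope_sumr (A \o s))//= sK s0.
rewrite (_ : _ * _ = C * t * (A t - A 0) / K.+1%:R); last by ring.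
by rewrite ler_pdivrMr// [leRHS]mulrC -ler_pdivrMr// ltW.
Qed.

Lemma measurable_exp_scale (c : R) :
  measurable_fun setT (fun s : R => expR (c * s)).
Proof. by apply: measurableT_comp => //; exact: mulrl_measurable. Qed.

Lemma expM_integrable (c : R) (f : R -> R) (u v : R) : 0 <= u ->
  mu.-integrable `[u, v] (EFin \o f) ->
  mu.-integrable `[u, v] (EFin \o (fun s => expR (c * s) * f s)).
Proof.
move=> u0 fi.
have := @integrableMr _ _ _ mu `[u, v]%classic _ (fun s => expR (c * s)) (EFin \o f).
apply => //.
  by apply: measurable_funTS; exact: measurable_exp_scale.
exists (expR (`|c| * v)); split; first exact: num_real.
move=> M ltM x /=; rewrite in_itv/= => /andP[ux xv].
rewrite ger0_norm ?expR_ge0// (le_trans _ (ltW ltM))// exp_scale_le//.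
by rewrite (le_trans u0 ux).
Qed.

(* On [u, v] the increments of both sides are e^(c u) \int_[u, v] f up to a
   multiple of (v - u) \int_[u, v] |f|, which is negligible on fine partitions. *)
Lemma exp_conv_primitive (c t : R) (f : R -> R) : 0 <= t ->
  (forall b, 0 <= b -> mu.-integrable `[0%R, b] (EFin \o f)) ->
  exp_conv c (fun t => \int[mu]_(s in `[0%R, t]) f s) t =
  \int[mu]_(s in `[0%R, t]) (expR (c * s) * f s).
Proof.
move=> t0 fi; set F := fun t : R => _.
have Fc : {within `[0%R, +oo[, continuous F} by exact: continuous_Rintegral_ray.
have fiuv u v : 0 <= u -> mu.-integrable `[u, v] (EFin \o f).
  move=> u0; have [uv|vu] := leP u v.
    by apply: (@integrable_itvS _ _ 0 v) => //; apply: fi; exact: le_trans uv.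
  by rewrite set_itv_ge ?bnd_simp -?ltNge//; exact: integrable_set0.
have nfiuv u v : 0 <= u -> mu.-integrable `[u, v] (EFin \o (fun s => `|f s|)).
  by move=> u0; apply: integrable_norm; exact: fiuv.
pose A := fun t : R => \int[mu]_(s in `[0%R, t]) `|f s|.
pose H := fun t : R => \int[mu]_(s in `[0%R, t]) (expR (c * s) * f s).
have FB u v : 0 <= u -> u <= v -> F v - F u = \int[mu]_(s in `[u, v]) f s.
  by move=> u0 uv; rewrite /F (Rintegral_itv_split u0 uv) ?fiuv// addrC addKr.
have HB u v : 0 <= u -> u <= v ->
    H v - H u = \int[mu]_(s in `[u, v]) (expR (c * s) * f s).
  move=> u0 uv; rewrite /H (Rintegral_itv_split u0 uv); first by rewrite addrC addKr.
  by apply: expM_integrable => //; exact: fiuv.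
have AB u v : 0 <= u -> u <= v -> A v - A u = \int[mu]_(s in `[u, v]) `|f s|.
  by move=> u0 uv; rewrite /A (Rintegral_itv_split u0 uv) ?nfiuv// addrC addKr.
have Amon u v : 0 <= u -> u <= v -> A u <= A v.
  by move=> u0 uv; rewrite -subr_ge0 AB// Rintegral_ge0.
pose C := `|c| * expR (`|c| * t).
suff : exp_conv c F t - H t = exp_conv c F 0 - H 0.
  move=> /eqP; rewrite subr_eq => /eqP ->.
  by rewrite /exp_conv /H /F !set_itv1 !Rintegral_set1 !mulr0 !subr0 add0r.
(* One [C] pays for [E1], where the integral of |f| dominates the oscillation of [F]; the other pays
   for [E2], where e^(c s) is frozen at [u] under the integral. *)
apply: (@additive_increments_eq0 (fun t => exp_conv c F t - H t) A (2 * C) t t0) => u v u0 uv vt.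
have Fosc s : u <= s <= v -> `|F v - F s| <= A v - A u.
  move=> /andP[us sv]; have s0 := le_trans u0 us.
  rewrite FB// (le_trans (le_normr_Rintegral _ _)) ?fiuv// -AB//.
  by rewrite lerD2l lerN2 Amon.
have E1 := exp_conv_incr c u0 uv vt Fc Fosc.
have E2 : `|(H v - H u) - expR (c * u) * (F v - F u)| <= C * (v - u) * (A v - A u).
  rewrite HB// FB// -RintegralZl ?fiuv// -RintegralB//; last 2 first.
  - by apply: expM_integrable => //; exact: fiuv.
  - by apply: integrable_EFinZl => //; exact: fiuv.
  apply: le_trans (le_normr_Rintegral _ _) _ => //.
    apply: integrable_EFinB => //.
      by apply: expM_integrable => //; exact: fiuv.
    by apply: integrable_EFinZl => //; exact: fiuv.
  rewrite AB// -RintegralZl ?nfiuv//.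
  apply: le_Rintegral => //.
  - apply: integrable_norm; apply: integrable_EFinB => //.
      by apply: expM_integrable => //; exact: fiuv.
    by apply: integrable_EFinZl => //; exact: fiuv.
  - by apply: integrable_EFinZl => //; exact: nfiuv.
  move=> s /=; rewrite in_itv/= => /andP[us sv].
  rewrite -mulrBl normrM ler_wpM2r//.
  apply: (le_trans (exp_scale_lipschitz c u0 us (le_trans sv vt))).
  by rewrite ler_wpM2l ?mulr_ge0 ?expR_ge0// lerD2r.
rewrite (_ : _ - _ = ((exp_conv c F v - exp_conv c F u) - expR (c * u) * (F v - F u))
   - ((H v - H u) - expR (c * u) * (F v - F u))); last by ring.
apply: le_trans (ler_normB _ _) _.
apply: le_trans (lerD E1 E2) _.
by rewrite /C le_eqVlt; apply/orP; left; apply/eqP; ring.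
Qed.

End ExpConvPrimitive.

(** * The product rule along a single path *)

Section ExpConvPath.
Context {R : realType}.
Local Notation mu := (@lebesgue_measure R).
Implicit Types (f g h : R -> R) (c s t u v : R).

Lemma exp_convD c f h t : 0 <= t ->
  {within `[0%R, +oo[, continuous f} -> {within `[0%R, +oo[, continuous h} ->
  exp_conv c (fun s => f s + h s) t = exp_conv c f t + exp_conv c h t.
Proof.
move=> t0 fc hc; rewrite /exp_conv.
have -> : \int[mu]_(s in `[0%R, t]) (expR (c * s) * (f s + h s)) =
    \int[mu]_(s in `[0%R, t]) (expR (c * s) * f s) +
    \int[mu]_(s in `[0%R, t]) (expR (c * s) * h s).
  rewrite -RintegralD//.
  - by apply: eq_Rintegral => s _; rewrite mulrDr.
  - by apply: within_ray_integrable => //; exact: within_continuous_expM.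
  - by apply: within_ray_integrable => //; exact: within_continuous_expM.
by ring.
Qed.

(** Constants are fixed, not sent to 0: [exp_conv] retains the initial value of the path, and so the
    initial condition [x] survives the weighting. *)
Lemma exp_conv_cst c x t : 0 <= t -> exp_conv c (fun=> x) t = x.
Proof.
move=> t0; rewrite /exp_conv RintegralZr//; last exact: exp_scale_integrable.
by rewrite mulrA Rintegral_exp_scale// mulr0 expR0 mulrBl mul1r opprB addrC subrK.
Qed.

Lemma eq_exp_conv c f h t : 0 <= t -> (forall s, 0 <= s <= t -> f s = h s) ->
  exp_conv c f t = exp_conv c h t.
Proof.
move=> t0 fh; rewrite /exp_conv fh ?t0 ?lexx//; congr (_ - _ * _).
by apply: eq_Rintegral => s; rewrite inE/= in_itv/= => /fh ->.
Qed.

(** Apply the additive map [exp_conv c] to both sides of the equation for [X]. The constant is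
    fixed, the drift integral is handled by [exp_conv_primitive], and moving c \int e^(c s) X(s) ds
    to the right creates the extra drift [c * X s]. *)
Lemma exp_conv_state c x (X f I : R -> R) :
  (forall b, 0 <= b -> mu.-integrable `[0%R, b] (EFin \o f)) ->
  {within `[0%R, +oo[, continuous I} ->
  (forall t, 0 <= t -> X t = x + \int[mu]_(s in `[0%R, t]) f s + I t) ->
  forall t, 0 <= t ->
  mu.-integrable `[0%R, t] (EFin \o (fun s => expR (c * s) * (f s + c * X s))) /\
  expR (c * t) * X t =
    x + \int[mu]_(s in `[0%R, t]) (expR (c * s) * (f s + c * X s)) +
    exp_conv c I t.
Proof.
move=> fi Ic XE t t0.
pose F t := \int[mu]_(s in `[0%R, t]) f s.
have Fc : {within `[0%R, +oo[, continuous F} by exact: continuous_Rintegral_ray.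
have xFc : {within `[0%R, +oo[, continuous (fun t => x + F t)}.
  apply/subspace_continuousP => y y0; apply: cvgD; first exact: cvg_cst.
  by move/subspace_continuousP : Fc; exact.
have Xc : {within `[0%R, +oo[, continuous X}.
  apply: (@subspace_eq_continuous _ _ _ (fun t => x + F t + I t)).
    by move=> y; rewrite inE/= in_itv/= andbT => y0; rewrite /from_subspace XE.
  apply/subspace_continuousP => y y0; apply: cvgD.
    by move/subspace_continuousP : xFc; exact.
  by move/subspace_continuousP : Ic; exact.
have efi : mu.-integrable `[0%R, t] (EFin \o (fun s => expR (c * s) * f s)).
  by apply: expM_integrable => //; exact: fi.
have eXi : mu.-integrable `[0%R, t] (EFin \o (fun s => expR (c * s) * X s)).
  by apply: within_ray_integrable => //; exact: within_continuous_expM.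
have ceXi : mu.-integrable `[0%R, t] (EFin \o (fun s => c * (expR (c * s) * X s))).
  exact: integrable_EFinZl.
have sumE : (fun s => expR (c * s) * (f s + c * X s)) =
    (fun s => expR (c * s) * f s + c * (expR (c * s) * X s)).
  by apply/funext => s; ring.
split; first by rewrite sumE; exact: integrable_EFinD.
rewrite sumE RintegralD// RintegralZl// -(exp_conv_primitive c t0 fi).
have : exp_conv c X t = x + exp_conv c F t + exp_conv c I t.
  rewrite (@eq_exp_conv _ _ (fun s => (x + F s) + I s))//; last first.
    by move=> s /andP[s0 _]; exact: XE.
  rewrite exp_convD// (@exp_convD c (fun=> x) F t)// ?exp_conv_cst//.
  by apply: continuous_subspaceT => y; exact: cvg_cst.
rewrite {1}/exp_conv => /eqP; rewrite subr_eq => /eqP ->.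
by ring.
Qed.

End ExpConvPath.

(** * Riemann sums of e^(c t) against a continuous path *)

Section Refinement.
Context {R : realType}.
Local Notation mu := (@lebesgue_measure R).
Implicit Types (W : R -> R).

Definition subdivision (a b : R) (K l : nat) : R := a + l%:R / K%:R * (b - a).

Lemma subdivision0 a b K : subdivision a b K 0 = a.
Proof. by rewrite /subdivision mul0r mul0r addr0. Qed.

Lemma subdivisionK a b K : (0 < K)%N -> subdivision a b K K = b.
Proof.
by move=> K0; rewrite /subdivision divff ?mul1r 1?addrC ?subrK// pnatr_eq0 -lt0n.
Qed.

Lemma subdivisionS a b K l :
  subdivision a b K l.+1 - subdivision a b K l = (b - a) / K%:R.
Proof. by rewrite /subdivision -natr1; ring. Qed.

Lemma subdivision_le a b K i j : a <= b -> (i <= j)%N ->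
  subdivision a b K i <= subdivision a b K j.
Proof.
by move=> ab ij; rewrite lerD2l ler_wpM2r ?subr_ge0// ler_wpM2r ?invr_ge0// ler_nat.
Qed.

Lemma within_ray_min W a : 0 <= a -> {within `[0%R, +oo[, continuous W} ->
  {within `[0%R, +oo[, continuous (fun t => W (Num.min t a))}.
Proof.
move=> a0 /subspace_continuousP Wc; apply/subspace_continuousP => x /=.
rewrite in_itv/= andbT => x0.
have mc : (fun t : R => Num.min t a) @ within `[0%R, +oo[ (nbhs x) -->
    within `[0%R, +oo[ (nbhs (Num.min x a)).
  move=> P /= Pm; rewrite nbhs_simpl/=.
  have : Num.min y a @[y --> x] --> Num.min x a.
    by apply: continuous_min; [exact: cvg_id|exact: cvg_cst].
  move=> /(_ _ Pm); rewrite /within/= nbhs_simpl/=.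
  apply: filterS => y /= + y0; apply.
  by move: y0; rewrite !in_itv/= !andbT le_min => ->.
apply: cvg_trans (Wc (Num.min x a) _); last by rewrite /= in_itv/= andbT le_min x0.
by apply: (cvg_comp _ _ mc) => //.
Qed.

(** The sum is compared with the increments of [exp_conv c h] over the subdivision stopped at [t].
    [exp_conv_incr] bounds each error by the length of its stopped piece, and these lengths add up
    to at most b - a. *)
Lemma exp_conv_riemann W (c a b T eta : R) (K : nat) (t : R) :
  0 <= a -> a <= b -> b <= T -> (0 < K)%N -> 0 <= t -> 0 <= eta ->
  {within `[0%R, +oo[, continuous W} ->
  (forall u v, 0 <= u -> u <= v -> v <= T -> v - u <= (b - a) / K%:R ->
    `|W v - W u| <= eta) ->
  `|\sum_(0 <= l < K) expR (c * subdivision a b K l) *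
       (W (Num.min t (subdivision a b K l.+1)) - W (Num.min t (subdivision a b K l)))
    - exp_conv c (fun t => W (Num.min t b) - W (Num.min t a)) t|
  <= eta * (`|c| * expR (`|c| * T)) * (b - a).
Proof.
move=> a0 ab bT K0 t0 eta0 Wc osc; set h := fun t : R => _ - _.
set s := subdivision a b K.
have b0 : 0 <= b by exact: le_trans ab.
have hc : {within `[0%R, +oo[, continuous h}.
  apply/subspace_continuousP => y y0; apply: cvgB.
    by have /subspace_continuousP := within_ray_min b0 Wc; exact.
  by have /subspace_continuousP := within_ray_min a0 Wc; exact.
have sle i j : (i <= j)%N -> s i <= s j by exact: subdivision_le.
have s0 : s 0%N = a by exact: subdivision0.
have sK : s K = b by exact: subdivisionK.
have hE0 : exp_conv c h (Num.min t a) = 0.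
  rewrite (@eq_exp_conv _ _ _ (fun=> 0)) ?exp_conv_cst ?le_min ?t0//.
  move=> u /andP[_]; rewrite le_min => /andP[_ ua].
  by rewrite /h !min_l// ?subrr// (le_trans ua ab).
(* Past [b] the path [h] is constant, so its oscillation is 0 and the transform no longer moves. *)
have hE1 : exp_conv c h t = exp_conv c h (Num.min t b).
  have [tb|bt] := leP t b; first by [].
  have hb u : b <= u -> h u = W b - W a.
    by move=> bu; rewrite /h !min_r// (le_trans ab bu).
  have := @exp_conv_incr _ c h b t t 0 b0 (ltW bt) (lexx _) hc.
  rewrite !mul0r !hb ?(ltW bt)// subrr mulr0 subr0.
  move=> H; apply/eqP; rewrite -subr_eq0 -normr_le0 H// => u /andP[bu _].
  by rewrite hb// subrr normr0.
have mE l : (l <= K)%N -> Num.min (Num.min t (s l)) b = Num.min t (s l).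
  by move=> lK; rewrite min_l// ge_min -sK sle// orbT.
have mE' l : Num.min (Num.min t (s l)) a = Num.min t a.
  by rewrite -minA [X in Num.min _ X]min_r// -s0 sle.
have -> : exp_conv c h t = \sum_(0 <= l < K)
    (exp_conv c h (Num.min t (s l.+1)) - exp_conv c h (Num.min t (s l))).
  by rewrite (telescope_sumr (fun l => exp_conv c h (Num.min t (s l))))// s0 sK hE0 subr0 hE1.
rewrite -sumrB.
apply: le_trans (ler_norm_sum _ _ _) _.
pose C := eta * (`|c| * expR (`|c| * T)).
apply: (@le_trans _ _ (\sum_(0 <= l < K) C * (Num.min t (s l.+1) - Num.min t (s l)))).
  rewrite !big_mkord; apply: ler_sum => l _.
  have lK := ltn_ord l.
  have u0 : 0 <= Num.min t (s l) by rewrite le_min t0 (le_trans a0)// -s0 sle.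
  have uv : Num.min t (s l) <= Num.min t (s l.+1).
    by rewrite le_min ge_min lexx/= ge_min sle ?orbT.
  have vT : Num.min t (s l.+1) <= T by rewrite ge_min (le_trans (_ : s l.+1 <= b) bT) ?orbT// -sK sle.
  have hW : h (Num.min t (s l.+1)) - h (Num.min t (s l)) =
      W (Num.min t (s l.+1)) - W (Num.min t (s l)).
    by rewrite /h !mE ?mE' ?(ltnW lK)//; ring.
  have sd : Num.min t (s l.+1) - Num.min t (s l) <= (b - a) / K%:R.
    rewrite -(subdivisionS a b K l) -/s.
    have [ts|st] := leP t (s l).
      by rewrite min_l ?subrr ?subr_ge0 ?sle// (le_trans ts) ?sle.
    by rewrite lerD2r ge_min lexx orbT.
  (* Stopping the argument of the exponential is harmless: if [t <= s l], both increments vanish. *)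
  have -> : expR (c * s l) * (W (Num.min t (s l.+1)) - W (Num.min t (s l))) =
      expR (c * Num.min t (s l)) * (h (Num.min t (s l.+1)) - h (Num.min t (s l))).
    rewrite hW; have [ts|//] := leP t (s l).
    by rewrite min_l ?subrr ?mulr0// (le_trans ts) ?sle.
  rewrite distrC; apply: exp_conv_incr => // u /andP[su ut].
  have u0' := le_trans u0 su.
  have hWu : h (Num.min t (s l.+1)) - h u = W (Num.min t (s l.+1)) - W u.
    have ub : u <= b.
      by rewrite (le_trans ut)// ge_min -sK sle ?orbT.
    (* If [t <= a], the stopped piece containing [u] is the single point [t]; otherwise the whole
       piece lies to the right of [a]. *)
    have ua : Num.min u a = Num.min t a.
      have [ta|at_] := leP t a.
        have tsl : t <= s l by rewrite (le_trans ta)// -s0 sle.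
        move: su; rewrite min_l// => tu.
        by apply/le_anti; rewrite le_min tu ta/= ge_min (le_trans ut)// ge_min lexx.
      by rewrite min_r// (le_trans _ su)// le_min (ltW at_) -s0 sle.
    by rewrite /h !mE ?mE'// (min_l ub) ua; ring.
  rewrite hWu osc// (le_trans _ sd)// lerD2l lerN2//.
rewrite -mulr_sumr (telescope_sumr (fun l => Num.min t (s l)))// s0 sK -/C.
rewrite ler_wpM2l ?mulr_ge0 ?expR_ge0//.
have [ta|at_] := leP t a.
  by rewrite min_l ?subrr ?subr_ge0// (le_trans ta).
by rewrite lerD2r ge_min lexx orbT.
Qed.

End Refinement.

(** * Refinement of simple processes *)

Section RefineSimple.
Context {d : measure_display} {Omega : measurableType d} {R : realType}.
Variable F : R -> set (set Omega).
Hypothesis F_mono : forall s t, 0 <= s -> s <= t -> F s `<=` F t.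
Implicit Types (H : simple_process F) (K : nat) (c : R).

Lemma measurable_fun_filtration_le s t (f : Omega -> R) : 0 <= s -> s <= t ->
  measurable_fun [set: g_sigma_algebraType (F s)]
    (f : g_sigma_algebraType (F s) -> R) ->
  measurable_fun [set: g_sigma_algebraType (F t)]
    (f : g_sigma_algebraType (F t) -> R).
Proof.
move=> s0 st mf _ B mB; have := mf measurableT B mB; rewrite !setTI.
exact: (@sub_sigma_algebra2 _ setT _ _ (F_mono s0 st)).
Qed.

(** Euclidean division by [K] flattens the pairs (interval of [H], subdivision point) into the
    single index that a simple process requires. *)
Definition refine_time H K p : R :=
  subdivision (sp_time H (p %/ K)) (sp_time H (p %/ K).+1) K (p %% K).

Lemma sp_time_nonneg H k : 0 <= sp_time H k.
Proof.
elim: k => [|k IH]; first exact: sp_time_ge0.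
exact: le_trans (sp_time_mono H k).
Qed.

Lemma sp_time_le H i j : (i <= j)%N -> sp_time H i <= sp_time H j.
Proof.
have : {homo sp_time H : i j / (i <= j)%N >-> i <= j}.
  by apply: homo_leq => //; [exact: le_trans|exact: sp_time_mono].
exact.
Qed.

(** No case distinction survives at the end of a block: the last subdivision point of one interval
    of [H] is the first of the next. *)
Lemma refine_timeS H K p : (0 < K)%N -> refine_time H K p.+1 =
  subdivision (sp_time H (p %/ K)) (sp_time H (p %/ K).+1) K (p %% K).+1.
Proof.
move=> K0; rewrite /refine_time.
have := ltn_pmod p K0; rewrite leq_eqVlt => /predU1P[pK|pK].
  have pE : p.+1 = ((p %/ K).+1 * K)%N.
    by rewrite mulSn [in LHS](divn_eq p K) -addnS pK addnC.
  by rewrite pE mulnK// modnMl subdivision0 pK subdivisionK.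
have -> : p.+1 = (p %/ K * K + (p %% K).+1)%N by rewrite addnS -divn_eq.
by rewrite divnMDl// (divn_small pK) addn0 modnMDl (modn_small pK).
Qed.

Lemma refine_time_jl H K j l : (l < K)%N ->
  refine_time H K (j * K + l) =
  subdivision (sp_time H j) (sp_time H j.+1) K l.
Proof.
move=> lK; have K0 : (0 < K)%N by exact: leq_ltn_trans lK.
by rewrite /refine_time divnMDl// divn_small// addn0 modnMDl modn_small.
Qed.

Lemma refine_timeS_jl H K j l : (l < K)%N ->
  refine_time H K (j * K + l).+1 =
  subdivision (sp_time H j) (sp_time H j.+1) K l.+1.
Proof.
move=> lK; have K0 : (0 < K)%N by exact: leq_ltn_trans lK.
by rewrite refine_timeS// divnMDl// divn_small// addn0 modnMDl modn_small.
Qed.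

Lemma refine_time_ge H K p : sp_time H (p %/ K) <= refine_time H K p.
Proof.
rewrite -[leLHS](subdivision0 _ (sp_time H (p %/ K).+1) K).
by apply: subdivision_le => //; exact: sp_time_mono.
Qed.

Lemma refine_time_ge0 H K : 0 <= refine_time H K 0.
Proof. exact: le_trans (sp_time_nonneg H _) (refine_time_ge H K 0). Qed.

Section Def.
Variables (c : R) (H : simple_process F) (K : nat) (K0 : (0 < K)%N).

(* e^(c t) is frozen at the left endpoint of each subinterval. *)
Let coef p w := expR (c * refine_time H K p) * sp_coef H (p %/ K) w.

Lemma refine_time_mono p : refine_time H K p <= refine_time H K p.+1.
Proof.
rewrite refine_timeS//; apply: subdivision_le; rewrite ?leqnSn//.
exact: sp_time_mono.
Qed.

Lemma refine_coef_measurable p :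
  measurable_fun [set: g_sigma_algebraType (F (refine_time H K p))]
    (coef p : g_sigma_algebraType (F (refine_time H K p)) -> R).
Proof.
apply: measurable_funM => //.
exact: (measurable_fun_filtration_le (sp_time_nonneg H _) (refine_time_ge H K p)
  (@sp_coef_measurable _ _ _ _ H (p %/ K))).
Qed.

Lemma refine_coef_bounded p : exists M, forall w, `|coef p w| <= M.
Proof.
have [M HM] := sp_coef_bounded H (p %/ K).
exists (expR (c * refine_time H K p) * M) => w.
by rewrite normrM ger0_norm ?expR_ge0// ler_wpM2l ?expR_ge0.
Qed.

Definition refine : simple_process F :=
  @SimpleProcess d Omega R F (sp_size H * K) (refine_time H K) coef
    (refine_time_ge0 H K) refine_time_mono refine_coef_measurable
    refine_coef_bounded.

(** One reindexing serves for values and integrals: [Phi a b] will be the indicator of ]a, b] at a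
    fixed time, or the increment of the stopped path between [a] and [b]. *)
Lemma refine_sum (Phi : R -> R -> R) w :
  \sum_(p < sp_size refine)
    sp_coef refine p w * Phi (sp_time refine p) (sp_time refine p.+1) =
  \sum_(j < sp_size H) sp_coef H j w * \sum_(0 <= l < K)
    expR (c * subdivision (sp_time H j) (sp_time H j.+1) K l) *
    Phi (subdivision (sp_time H j) (sp_time H j.+1) K l)
        (subdivision (sp_time H j) (sp_time H j.+1) K l.+1).
Proof.
rewrite -(big_mkord xpredT (fun p =>
  sp_coef refine p w * Phi (sp_time refine p) (sp_time refine p.+1))) /=.
rewrite big_nat_mul big_mkord; apply: eq_bigr => j _.
rewrite mulr_sumr mulSn addnC -{1}[(j * K)%N]add0n big_addn addKn.
rewrite !big_mkord; apply: eq_bigr => l _.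
rewrite [(l + j * K)%N]addnC /coef refine_time_jl// refine_timeS_jl//.
by rewrite divnMDl// divn_small// addn0; ring.
Qed.

End Def.

(** By linearity of [exp_conv], [exp_conv_riemann] may be used on each interval of [H] with its
    coefficient; the interval lengths telescope to at most [T]. *)
Lemma sp_int_refine (W : R -> Omega -> R) c H K (K0 : (0 < K)%N) (T eta M t : R) w :
  0 <= t -> 0 <= eta -> 0 <= T -> 0 <= M ->
  sp_time H (sp_size H) <= T ->
  (forall j, (j < sp_size H)%N -> `|sp_coef H j w| <= M) ->
  {within `[0%R, +oo[, continuous W ^~ w} ->
  (forall u v, 0 <= u -> u <= v -> v <= T -> v - u <= T / K%:R ->
    `|W v w - W u w| <= eta) ->
  `|sp_int W (refine c H K0) t w - exp_conv c (sp_int W H ^~ w) t| <=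
  M * (eta * (`|c| * expR (`|c| * T))) * T.
Proof.
move=> t0 eta0 T0 M0 HT HM Wc osc.
pose n := sp_size H.
pose Mj j t := W (Num.min t (sp_time H j.+1)) w - W (Num.min t (sp_time H j)) w.
have Mjc j : {within `[0%R, +oo[, continuous (Mj j)}.
  apply/subspace_continuousP => y y0; apply: cvgB.
    by have /subspace_continuousP := within_ray_min (sp_time_nonneg H j.+1) Wc; exact.
  by have /subspace_continuousP := within_ray_min (sp_time_nonneg H j) Wc; exact.
have kMc j : {within `[0%R, +oo[, continuous (fun t => sp_coef H j w * Mj j t)}.
  apply/subspace_continuousP => y y0; apply: cvgM; first exact: cvg_cst.
  by have /subspace_continuousP := Mjc j; exact.
pose S m t := \sum_(0 <= j < m) sp_coef H j w * Mj j t.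
have S0 : S 0%N = fun=> 0 by apply/funext => u; rewrite /S big_geq.
have SS m : S m.+1 = fun t => S m t + sp_coef H m w * Mj m t.
  by apply/funext => u; rewrite /S big_nat_recr.
(* Continuity of the partial sums goes through the same induction because [exp_convD] asks for
   it. *)
have lin m : {within `[0%R, +oo[, continuous (S m)} /\
    exp_conv c (S m) t = \sum_(0 <= j < m) sp_coef H j w * exp_conv c (Mj j) t.
  elim: m => [|m [IHc IH]].
    rewrite S0 exp_conv_cst// big_geq//; split => //.
    by apply: continuous_subspaceT => y; exact: cvg_cst.
  rewrite SS big_nat_recr//=; split.
    apply/subspace_continuousP => y y0; apply: cvgD.
      by move/subspace_continuousP : IHc; exact.
    by have /subspace_continuousP := kMc m; exact.
  rewrite exp_convD// IH; congr (_ + _).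
  rewrite /exp_conv [RHS]mulrBr; congr (_ - _); first by ring.
  rewrite [RHS]mulrCA; congr (_ * _); rewrite -RintegralZl//; last first.
    by apply: within_ray_integrable => //; exact: within_continuous_expM.
  by apply: eq_Rintegral => s _; ring.
have -> : sp_int W H ^~ w = S n.
  by apply/funext => u; rewrite /S big_mkord.
rewrite (lin n).2.
rewrite /sp_int (refine_sum _ _ _ (fun a b => W (Num.min t b) w - W (Num.min t a) w)).
rewrite big_mkord -sumrB.
apply: le_trans (ler_norm_sum _ _ _) _.
pose C := M * (eta * (`|c| * expR (`|c| * T))).
have C0 : 0 <= C by rewrite !mulr_ge0// expR_ge0.
apply: (@le_trans _ _ (\sum_(0 <= j < n) C * (sp_time H j.+1 - sp_time H j))).
  rewrite big_mkord; apply: ler_sum => j _.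
  rewrite -mulrBr normrM /C -mulrA ler_pM//; first exact: HM.
  apply: (@exp_conv_riemann _ (W ^~ w) c (sp_time H j) (sp_time H j.+1) T eta K t) => //.
  - exact: sp_time_nonneg.
  - exact: sp_time_mono.
  - by rewrite (le_trans _ HT)// sp_time_le.
  - move=> u v u0 uv vT uvK; apply: osc => //; rewrite (le_trans uvK)//.
    rewrite ler_wpM2r ?invr_ge0// lerBlDr (le_trans _ (le_trans HT _))//.
      by rewrite sp_time_le.
    by rewrite lerDl sp_time_nonneg.
rewrite -mulr_sumr telescope_sumr// -/C ler_wpM2l//.
by rewrite lerBlDr (le_trans HT)// lerDl sp_time_nonneg.
Qed.

(** Within each interval of [H] at most one subinterval contains [t]; there e^(c t) differs from its
    frozen value by the Lipschitz constant times the mesh. Summing over the intervals of [H] is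
    crude but sufficient, since [K] is chosen after [H]. *)
Lemma sp_val_refine c H K (K0 : (0 < K)%N) (T M t : R) w :
  0 <= T -> 0 <= M -> sp_time H (sp_size H) <= T ->
  (forall j, (j < sp_size H)%N -> `|sp_coef H j w| <= M) ->
  `|sp_val (refine c H K0) t w - expR (c * t) * sp_val H t w| <=
  (sp_size H)%:R * (M * (`|c| * expR (`|c| * T) * (T / K%:R))).
Proof.
move=> T0 M0 HT HM.
have indB (a b : R) : a <= b -> ((a < t <= b)%R)%:R = ((a < t)%R)%:R - ((b < t)%R)%:R :> R.
  move=> ab; rewrite leNgt; have [bt|tb] := ltP b t.
    by rewrite (le_lt_trans ab bt) /= subrr.
  by rewrite andbT subr0.
rewrite /sp_val (refine_sum _ _ _ (fun a b => ((a < t <= b)%R)%:R)) mulr_sumr -sumrB.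
apply: le_trans (ler_norm_sum _ _ _) _.
pose C := `|c| * expR (`|c| * T).
have C0 : 0 <= C by rewrite !mulr_ge0// expR_ge0.
have -> : (sp_size H)%:R * (M * (C * (T / K%:R))) =
    \sum_(j < sp_size H) (M * (C * (T / K%:R))).
  by rewrite sumr_const card_ord mulr_natl.
apply: ler_sum => j _; rewrite mulrCA -mulrBr normrM ler_pM//; first exact: HM.
set s := subdivision _ _ K.
have sle i k : (i <= k)%N -> s i <= s k.
  by apply: subdivision_le; exact: sp_time_mono.
have s0 : s 0%N = sp_time H j by exact: subdivision0.
have sK : s K = sp_time H j.+1 by exact: subdivisionK.
have jT : sp_time H j.+1 <= T by rewrite (le_trans _ HT)// sp_time_le.
(* The indicator of ]a, b] is a difference of indicators of two rays, so the sum telescopes. *)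
have tele : \sum_(0 <= l < K) ((s l < t <= s l.+1)%R)%:R =
    ((sp_time H j < t <= sp_time H j.+1)%R)%:R :> R.
  rewrite (indB _ _ (sp_time_mono H j)) -s0 -sK.
  rewrite -[RHS]opprB -(telescope_sumr (fun l => ((s l < t)%R)%:R))// -sumrN.
  by apply: eq_bigr => l _; rewrite indB ?sle// opprB.
rewrite -tele mulr_sumr -sumrB.
apply: le_trans (ler_norm_sum _ _ _) _.
apply: (@le_trans _ _ (\sum_(0 <= l < K) (C * (T / K%:R)) * ((s l < t <= s l.+1)%R)%:R)).
  rewrite !big_mkord; apply: ler_sum => l _; rewrite -mulrBl normrM.
  have [/andP[slt tsl]|] := boolP (s l < t <= s l.+1); last by rewrite normr0 !mulr0.
  rewrite normr1 !mulr1 distrC.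
  have sl0 : 0 <= s l by rewrite (le_trans (sp_time_nonneg H j))// -s0 sle.
  apply: (le_trans (exp_scale_lipschitz c sl0 (ltW slt) (_ : t <= T))).
    by rewrite (le_trans tsl)// (le_trans _ jT)// -sK sle.
  rewrite -/C ler_wpM2l//.
  apply: (@le_trans _ _ (s l.+1 - s l)); first by rewrite lerD2r.
  rewrite subdivisionS ler_wpM2r ?invr_ge0//.
  by rewrite lerBlDr (le_trans jT)// lerDl sp_time_nonneg.
rewrite -mulr_sumr tele ler_piMr ?mulr_ge0 ?invr_ge0//.
by case: (_ < _ <= _).
Qed.

End RefineSimple.

(** * Measurability of pathwise suprema and modulus of continuity in probability *)

Section UniformContinuity.
Context {R : realType}.
Implicit Types (h : R -> R).

Lemma within_ray_eps h x e : 0 <= x -> 0 < e ->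
  {within `[0%R, +oo[, continuous h} ->
  exists2 del, 0 < del & forall y, 0 <= y -> `|x - y| < del -> `|h x - h y| < e.
Proof.
move=> x0 e0 /subspace_continuousP/(_ x); rewrite /= in_itv/= x0 => /(_ isT).
move/cvgrPdist_lt => /(_ e e0); rewrite near_withinE => -[del /= del0 H].
by exists del => // y y0 xy; apply: H; rewrite //= in_itv/= y0.
Qed.

(** Heine-Cantor: compactness of [[0, T]], in its near-covering form, makes one [K] work for all
    points. *)
Lemma within_ray_unif h T e : 0 < e ->
  {within `[0%R, +oo[, continuous h} ->
  exists K : nat, forall s t, 0 <= s <= T -> 0 <= t <= T ->
    `|s - t| < K.+1%:R^-1 -> `|h s - h t| <= e.
Proof.
move=> e0 hc.
have /compact_near_coveringP/near_covering_withinP cov := @segment_compact R 0 T.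
have /cov : forall x, x \in `[0, T] ->
    \forall x' \near x & K \near \oo, x' \in `[0, T] ->
    forall s, 0 <= s <= T -> `|s - x'| < K.+1%:R^-1 -> `|h s - h x'| <= e.
  move=> x; rewrite in_itv/= => /andP[x0 xT].
  have e20 : 0 < e / 2 by rewrite divr_gt0.
  have [del del0 H] := within_ray_eps x0 e20 hc.
  have del20 : 0 < del / 2 by rewrite divr_gt0.
  near=> x' K; rewrite in_itv/= => /andP[x'0 x'T] s /andP[s0 sT] sx'.
  have xx' : `|x - x'| < del / 2.
    by near: x'; apply/nbhs_ballP; exists (del / 2).
  have Kd : K.+1%:R^-1 < del / 2 by near: K; exact: near_infty_natSinv_lt (PosNum del20).
  have xs : `|x - s| < del.
    rewrite (le_lt_trans (ler_distD x' _ _))// (splitr del) ltrD//.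
    by rewrite distrC (lt_trans sx').
  rewrite (le_trans (ler_distD (h x) _ _))// (splitr e) lerD// ltW//.
    by rewrite distrC H.
  by rewrite H// (lt_le_trans xx')// ler_pdivrMr// ler_peMr// ?ler1n// ltW.
move=> [K _ HK]; exists K => s t s0T t0T st.
by apply: (HK K (leqnn K) t) => //; rewrite in_itv.
Unshelve. all: by end_near. Qed.

End UniformContinuity.

Section PathMeasurability.
Context {d : measure_display} {Omega : measurableType d} {R : realType}.
Local Notation mu := (@lebesgue_measure R).

(** Truncating |q| at [T] turns every rational into a time of [[0, T]] and reaches the endpoint [T]
    even when it is irrational. The rational is taken slightly to the right of [t]. *)
Lemma path_dense (f : R -> R) (T t e : R) :
  {within `[0%R, +oo[, continuous f} -> 0 <= t <= T -> 0 < e ->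
  exists q : rat, `|t - Num.min T `|ratr q| | < e /\
    `|f t - f (Num.min T `|ratr q|)| < e.
Proof.
move=> fc /andP[t0 tT] e0; have [del del0 H] := within_ray_eps t0 e0 fc.
have [q] : exists q, ratr q \in `]t, (t + Num.min e del)[.
  by apply: rat_in_itvoo; rewrite ltrDl lt_min e0.
rewrite in_itv/= => /andP[tq qt]; exists q.
have q0 : 0 <= ratr q :> R by rewrite ltW// (le_lt_trans t0).
have tm : `|t - Num.min T `|ratr q| | < Num.min e del.
  rewrite (ger0_norm q0) ler0_norm; last by rewrite subr_le0 le_min tT ltW.
  by rewrite opprB ltrBlDl gt_min qt orbT.
move: tm; rewrite lt_min => /andP[te td]; split => //.
by rewrite H// le_min (le_trans t0 tT) normr_ge0.
Qed.

(** A strict inequality persists at nearby times of a continuous path, so the existential over [t]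
    reduces to a countable union. *)
Lemma measurable_exists_gt (f : R -> Omega -> R) (D : set Omega) (T e : R) :
  measurable D -> 0 <= T -> continuous_paths f ->
  (forall t, 0 <= t -> measurable_fun D (f t)) ->
  measurable (D `&` [set w | exists t, 0 <= t <= T /\ e < `|f t w|]).
Proof.
move=> mD T0 fc mf.
rewrite (_ : _ `&` _ = \bigcup_(q : rat)
  (D `&` (fun w => `|f (Num.min T `|ratr q|) w|) @^-1` `]e, +oo[%classic)).
  apply: bigcupT_measurable_rat => q.
  have mfq : measurable_fun D (f (Num.min T `|ratr q|)).
    by apply: mf; rewrite le_min T0 normr_ge0.
  by apply: (measurableT_comp (@normr_measurable R setT) mfq) => //; exact: measurable_itv.
apply/seteqP; split => [w /= [Dw [t [tT et]]]|w /= [q _ [Dw]]]; last first.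
  rewrite /= in_itv/= andbT => eq; split => //.
  exists (Num.min T `|ratr q|); split => //.
  by rewrite le_min T0 normr_ge0 ge_min lexx.
have [q [_ fq]] : exists q : rat, `|t - Num.min T `|ratr q| | < `|f t w| - e /\
    `|f t w - f (Num.min T `|ratr q|) w| < `|f t w| - e.
  by apply: (@path_dense (f ^~ w)) => //; rewrite subr_gt0.
exists q => //; split => //=; rewrite in_itv/= andbT.
rewrite -ltrN2 -(ltrD2l `|f t w|) (le_lt_trans _ fq)//.
by rewrite (le_trans (lerB_dist _ _)).
Qed.

(** The bad events [B K] only compare countably many times, hence are measurable. They decrease with
    [K], and have empty intersection by uniform continuity of each path, so continuity from above
    gives small probability; density then covers all [u] and [v]. *)
Lemma modulus_in_probability (Q : probability Omega R) (W : R -> Omega -> R)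
    (T eta eps : R) : 0 < eta -> 0 < eps ->
  continuous_paths W ->
  (forall t, 0 <= t -> measurable_fun setT (W t)) ->
  exists (K : nat) (B : set Omega),
    [/\ measurable B, (Q B < eps%:E)%E &
     forall w, ~ B w -> forall u v, 0 <= u -> u <= v -> v <= T ->
       v - u < K.+1%:R^-1 -> `|W v w - W u w| <= eta].
Proof.
move=> eta0 eps0 Wc mW.
have [T0|T0] := leP 0 T; last first.
  exists 0%N, set0; split => //; first by rewrite measure0 lte_fin.
  move=> w _ u v u0 uv vT.
  by have := le_trans (le_trans u0 uv) vT; rewrite leNgt T0.
pose tau (q : rat) : R := Num.min T `|ratr q|.
have tau0 q : 0 <= tau q by rewrite /tau le_min T0 normr_ge0.
have tauT q : tau q <= T by rewrite /tau ge_min lexx.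
pose G (K : nat) (p q : rat) : set Omega :=
  if `|tau p - tau q| < K.+1%:R^-1 then
    (fun w => `|W (tau p) w - W (tau q) w|) @^-1` `]eta, +oo[%classic
  else set0.
pose B K : set Omega := \bigcup_(p : rat) \bigcup_(q : rat) G K p q.
have mB K : measurable (B K).
  apply: bigcupT_measurable_rat => p; apply: bigcupT_measurable_rat => q.
  rewrite /G; case: ifP => // _; rewrite -[X in measurable X]setTI.
  have mpq : measurable_fun setT (fun w => W (tau p) w - W (tau q) w).
    by apply: measurable_funB; exact: mW.
  by apply: (measurableT_comp (@normr_measurable R setT) mpq) => //; exact: measurable_itv.
have Bni : nonincreasing_seq B.
  move=> i j ij; apply/subsetPset => w [p _ [q _]] Gj; exists p => //; exists q => //.
  move: Gj; rewrite /G; case: ifP => // pq H; rewrite ifT//.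
  by rewrite (lt_le_trans pq)// lef_pV2 ?posrE// ler_nat.
have B0 : \bigcap_K B K = set0.
  apply/seteqP; split => // w Bw.
  have [K HK] := within_ray_unif T eta0 (Wc w).
  have [p _ [q _]] := Bw K Logic.I; rewrite /G; case: ifP => // pq.
  rewrite /= in_itv/= andbT => H.
  have := HK (tau p) (tau q); rewrite !tau0 !tauT pq => /(_ isT isT isT).
  by rewrite leNgt H.
have := nonincreasing_cvg_mu (mu := Q) _ mB _ Bni.
rewrite B0 measure0 => /(_ _ measurable0) H.
have {}H : (Q \o B) @ \oo --> 0%E.
  by apply: H; rewrite (le_lt_trans (probability_le1 Q (mB _)))// ltry.
have [K _ HK] : \forall K \near \oo, (Q (B K) < eps%:E)%E.
  apply: (H [set x | (x < eps%:E)%E]).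
  by apply: open_nbhs_nbhs; split => /=; [exact: open_ereal_lt_ereal|rewrite lte_fin].
exists K, (B K); split => //; first exact: (HK K (leqnn K)).
move=> w nBw u v u0 uv vT vu.
rewrite leNgt; apply/negP => H'.
(* Two approximations by rational times are made; each may use half of the slack in the strict
   inequalities, [e1] in value and [e2] in time. *)
pose e1 := (`|W v w - W u w| - eta) / 2.
have e10 : 0 < e1 by rewrite divr_gt0 // subr_gt0.
pose e2 := (K.+1%:R^-1 - (v - u)) / 2.
have e20 : 0 < e2 by rewrite divr_gt0 // subr_gt0.
have e120 : 0 < Num.min e1 e2 by rewrite lt_min e10.
have vI : 0 <= v <= T by rewrite vT (le_trans u0).
have uI : 0 <= u <= T by rewrite u0 (le_trans uv).
have [p []] := path_dense (Wc w) vI e120.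
rewrite !lt_min -/(tau p) => /andP[_ p2] /andP[p1 _].
have [q []] := path_dense (Wc w) uI e120.
rewrite !lt_min -/(tau q) => /andP[_ q2] /andP[q1 _].
apply: nBw; exists p => //; exists q => //.
have uv0 : 0 <= v - u by rewrite subr_ge0.
rewrite /G ifT/=.
  rewrite in_itv/= andbT.
  have : `|W v w - W u w| <= `|W v w - W (tau p) w| + `|W (tau p) w - W (tau q) w| + `|W u w - W (tau q) w|.
    rewrite (distrC (W u w)).
    apply: le_trans (ler_distD (W (tau q) w) _ _) _; rewrite lerD2r.
    exact: ler_distD.
  by move: p1 q1; rewrite /e1; lra.
have : `|tau p - tau q| <= `|v - tau p| + (v - u) + `|u - tau q|.
  rewrite (distrC v) -{1}(ger0_norm uv0).
  apply: le_trans (ler_distD u _ _) _; rewrite lerD2r.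
  exact: ler_distD.
by move: p2 q2; rewrite /e2; move: (K.+1%:R^-1) => k; lra.
Qed.

End PathMeasurability.

(** * Joint measurability in time and chance *)

Section JointMeasurability.
Context {d : measure_display} {Omega : measurableType d} {R : realType}.
Local Notation mu := (@lebesgue_measure R).

Definition jointly_measurable (f : R -> Omega -> R) :=
  measurable_fun (`[(0 : R), +oo[%classic `*` [set: Omega])
    (fun z : R * Omega => f z.1 z.2).

Lemma measurable_rayT :
  measurable (`[(0 : R), +oo[%classic `*` [set: Omega] : set (R * Omega)).
Proof. by apply: measurableX => //; exact: measurable_itv. Qed.

(** Exhaust the ray by the segments [[0, k]]; on each, the identity from the ambient sigma-algebra
    to the one generated by [F k] is measurable. *)
Lemma progressive_jointly_measurable (F : R -> set (set Omega)) f :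
  (forall t, 0 <= t -> F t `<=` measurable) ->
  progressive F f -> jointly_measurable f.
Proof.
move=> Fm pf; rewrite /jointly_measurable.
have -> : (`[(0 : R), +oo[%classic `*` [set: Omega] : set (R * Omega)) =
    \bigcup_(k : nat) (`[0%R, k%:R]%classic `*` [set: Omega]).
  apply/seteqP; split=> [[t w] /= []|[t w] /= [k _ []]]; rewrite /= !in_itv/=.
    rewrite andbT => t0 _; exists (Num.bound t) => //=; split=> //.
    by rewrite in_itv/= t0 ltW// archi_boundP.
  by move=> /andP[-> _].
apply/measurable_fun_bigcup => [k|k].
  by apply: measurableX => //; exact: measurable_itv.
have k0 : 0 <= k%:R :> R by [].
have mid : measurable_fun [set: Omega] (id : Omega -> g_sigma_algebraType (F k%:R)).
  move=> _ B mB; rewrite setTI.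
  have sub : <<s F k%:R >> `<=` d.-measurable.
    by apply: smallest_sub; [exact: sigma_algebra_measurable|exact: Fm].
  exact: sub.
have mpair : measurable_fun [set: R * Omega]
    (fun z : R * Omega => (z.1, z.2 : g_sigma_algebraType (F k%:R))).
  apply: measurable_fun_pair => //.
  by apply: (measurableT_comp mid); exact: measurable_snd.
move=> mD B mB.
have := pf k%:R k0 _ B mB.
have mD' : measurable (`[0%R, k%:R]%classic `*` [set: g_sigma_algebraType (F k%:R)]
    : set (R * g_sigma_algebraType (F k%:R))).
  by apply: measurableX => //; exact: measurable_itv.
by move=> /(_ mD') H; have := mpair measurableT _ H; rewrite setTI.
Qed.

Lemma jointly_measurable_at f t : 0 <= t -> jointly_measurable f ->
  measurable_fun setT (f t).
Proof.
move=> t0 mf _ B mB; have := mf measurable_rayT B mB.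
move=> /(measurable_xsection t); rewrite setTI; congr (measurable _).
apply/seteqP; split=> w; rewrite /xsection/= inE/= in_itv/= t0; first by move=> [].
by move=> H; split.
Qed.

Lemma jointly_measurable_path f w : jointly_measurable f ->
  measurable_fun `[(0 : R), +oo[ (f ^~ w).
Proof.
move=> mf _ B mB; have := mf measurable_rayT B mB.
move=> /(measurable_ysection w); congr (measurable _).
apply/seteqP; split=> t; rewrite /ysection/= inE/= in_itv/=.
  by move=> [[]].
by move=> [].
Qed.

Lemma jointly_measurable_itv f t : jointly_measurable f ->
  measurable_fun (`[(0 : R), t]%classic `*` [set: Omega]) (fun z : R * Omega => f z.1 z.2).
Proof.
apply: measurable_funS; first exact: measurable_rayT.
by move=> [s w] /= []; rewrite !in_itv/= => /andP[-> _].
Qed.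

(** Tonelli's theorem for the extension of [f] by zero to all times. *)
Lemma measurable_ge0_integral_itv (f : R -> Omega -> \bar R) t :
  (forall s w, (0 <= f s w)%E) ->
  measurable_fun (`[(0 : R), t]%classic `*` [set: Omega]) (fun z : R * Omega => f z.1 z.2) ->
  measurable_fun setT (fun w => \int[mu]_(s in `[0%R, t]) f s w)%E.
Proof.
move=> f0 mf.
have mD : measurable (`[(0 : R), t]%classic `*` [set: Omega] : set (R * Omega)).
  by apply: measurableX => //; exact: measurable_itv.
have mf' := (measurable_restrictT _ mD).1 mf.
have := @measurable_fun_fubini_tonelli_G _ _ (measurableTypeR R) Omega R mu _ mf'.
rewrite (_ : fubini_G _ _ = (fun w => \int[mu]_(s in `[0%R, t]) f s w)%E).
  by apply; move=> z; rewrite patchE; case: ifP.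
apply/funext => w; rewrite /fubini_G [RHS]integral_mkcond.
apply: eq_integral => s _; rewrite !patchE.
by congr (if _ then _ else _); apply/idP/idP; rewrite !inE/=; [case|].
Qed.

(** Positive and negative parts are integrated separately; [fine], which sends infinite values to 0,
    is measurable. *)
Lemma jointly_measurable_Rintegral f t : jointly_measurable f ->
  measurable_fun setT (fun w => \int[mu]_(s in `[0%R, t]) f s w).
Proof.
move=> /(jointly_measurable_itv (t := t)) mf; rewrite /Rintegral.
apply: (measurableT_comp (@fine_measurable R setT measurableT)).
under eq_fun do rewrite integralE.
have mEf : measurable_fun (`[(0 : R), t]%classic `*` [set: Omega])
    (fun z : R * Omega => (f z.1 z.2)%:E) by exact/measurable_EFinP.
apply: emeasurable_funB; apply: measurable_ge0_integral_itv => //.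
  apply: eq_measurable_fun (measurable_funepos mEf) => z _.
  by rewrite !funeposE.
apply: eq_measurable_fun (measurable_funeneg mEf) => z _.
by rewrite !funenegE.
Qed.

End JointMeasurability.

Section JointMeasurabilityAlgebra.
Context {d : measure_display} {Omega : measurableType d} {R : realType}.
Implicit Types f g : R -> Omega -> R.

Lemma jointly_measurableD f g : jointly_measurable f -> jointly_measurable g ->
  jointly_measurable (fun t w => f t w + g t w).
Proof. by move=> mf mg; exact: measurable_funD. Qed.

Lemma jointly_measurableM f g : jointly_measurable f -> jointly_measurable g ->
  jointly_measurable (fun t w => f t w * g t w).
Proof. by move=> mf mg; exact: measurable_funM. Qed.

Lemma jointly_measurable_sum (I : Type) (s : seq I) (f : I -> R -> Omega -> R) :
  (forall i, jointly_measurable (f i)) ->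
  jointly_measurable (fun t w => \sum_(i <- s) f i t w).
Proof.
move=> mf; elim: s => [|i s IH].
  by apply: eq_measurable_fun (measurable_cst (0 : R)) => z _; rewrite big_nil.
apply: eq_measurable_fun (jointly_measurableD (mf i) IH) => z _.
by rewrite big_cons.
Qed.

Lemma jointly_measurable_time (f : R -> R) : measurable_fun setT f ->
  jointly_measurable (fun t (_ : Omega) => f t).
Proof.
move=> mf; apply: measurable_funTS.
by apply: (measurableT_comp mf); exact: measurable_fst.
Qed.

Lemma jointly_measurable_omega (f : Omega -> R) : measurable_fun setT f ->
  jointly_measurable (fun _ w => f w).
Proof.
move=> mf; apply: measurable_funTS.
by apply: (measurableT_comp mf); exact: measurable_snd.
Qed.

(** On a grid of mesh 1/(k+1), replace each time by the right end of its cell. By right-continuity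
    in a discrete space the sampled regime is eventually the true one, so the event is the lower
    limit of the measurable sets [C k]. *)
Lemma right_continuous_jointly_measurable L (alpha : R -> Omega -> 'I_L) i :
  (forall t j, measurable (alpha t @^-1` [set j])) ->
  (forall w t, 0 <= t -> \forall s \near t^'+, alpha s w = alpha t w) ->
  measurable ((`[(0 : R), +oo[%classic `*` [set: Omega]) `&`
    [set z : R * Omega | alpha z.1 z.2 = i]).
Proof.
move=> malpha rc.
pose s (k q : nat) : R := q%:R / k.+1%:R.
pose C k : set (R * Omega) := \bigcup_(q : nat)
  (`[s k q, s k q.+1[%classic `*` (alpha (s k q.+1) @^-1` [set i])).
have mC k : measurable (C k).
  apply: bigcupT_measurable => q; apply: measurableX => //; exact: measurable_itv.
have k0 k : 0 < k.+1%:R :> R by [].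
have CE k t w : 0 <= t -> C k (t, w) <-> alpha (s k (Num.trunc (t * k.+1%:R)).+1) w = i.
  move=> t0; have tk0 : 0 <= t * k.+1%:R by rewrite mulr_ge0.
  split.
    move=> [q _ [/=]]; rewrite in_itv/= /s ler_pdivrMr// ltr_pdivlMr// => qt.
    suff -> : Num.trunc (t * k.+1%:R) = q by [].
    exact: truncn_def.
  move=> H; exists (Num.trunc (t * k.+1%:R)) => //; split => //=.
  by rewrite in_itv/= /s ler_pdivrMr// ltr_pdivlMr// truncn_itv.
have ev t w : 0 <= t -> exists K, forall k, (K <= k)%N ->
    alpha (s k (Num.trunc (t * k.+1%:R)).+1) w = alpha t w.
  move=> t0; have [del /= del0 H] := rc w t t0.
  have [K _ HK] := near_infty_natSinv_lt (PosNum del0).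
  exists K => k Kk.
  have /andP[h1 h2] := truncn_itv (mulr_ge0 t0 (ltW (k0 k))).
  (* Cells are open on the right, so the sampling time strictly exceeds [t], as a right
     neighbourhood demands. *)
  have lo : t < s k (Num.trunc (t * k.+1%:R)).+1 by rewrite /s ltr_pdivlMr.
  apply: H => //=; rewrite ltr0_norm ?subr_lt0// opprB.
  apply: le_lt_trans (HK k Kk).
  by rewrite /s lerBlDl -natr1 mulrDl mul1r lerD2r ler_pdivrMr.
rewrite (_ : _ `&` _ = (`[(0 : R), +oo[%classic `*` [set: Omega]) `&`
    \bigcup_K \bigcap_(k in [set k | (K <= k)%N]) C k).
  apply: measurableI; first exact: measurable_rayT.
  by apply: bigcupT_measurable => K; apply: bigcap_measurableType => k _.
apply/seteqP; split => [[t w] /= [[t0 _] ai]|[t w] /= [[t0 _] [K _ HK]]].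
  split => //; have t0' : 0 <= t by move: t0; rewrite in_itv/= andbT.
  have [K HK] := ev t w t0'.
  by exists K => // k /= Kk; apply/(CE k t w t0'); rewrite HK.
have t0' : 0 <= t by move: t0; rewrite in_itv/= andbT.
split => //; have [K' HK'] := ev t w t0'.
rewrite -(HK' (maxn K K') (leq_maxr _ _)).
by apply/(CE _ _ _ t0')/HK; exact: leq_maxl.
Qed.

Lemma jointly_measurable_regime L (alpha : R -> Omega -> 'I_L) (f : 'I_L -> R) :
  (forall t j, measurable (alpha t @^-1` [set j])) ->
  (forall w t, 0 <= t -> \forall s \near t^'+, alpha s w = alpha t w) ->
  jointly_measurable (fun t w => f (alpha t w)).
Proof.
move=> malpha rc _ B mB.
rewrite (_ : _ `&` _ = \bigcup_(i in [set i | B (f i)])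
  ((`[(0 : R), +oo[%classic `*` [set: Omega]) `&`
    [set z : R * Omega | alpha z.1 z.2 = i])).
  apply: fin_bigcup_measurable => [|i _]; first exact: finite_finset.
  exact: right_continuous_jointly_measurable.
apply/seteqP; split => [z /= [z0 Bz]|z /= [i Bi [z0 zi]]].
  by exists (alpha z.1 z.2).
by split => //; rewrite /= zi.
Qed.

Lemma jointly_measurable_mulmx L p n (alpha : R -> Omega -> 'I_L)
    (M : 'I_L -> 'M[R]_(p, n)) (X : @process d Omega R n) j :
  (forall t j, measurable (alpha t @^-1` [set j])) ->
  (forall w t, 0 <= t -> \forall s \near t^'+, alpha s w = alpha t w) ->
  (forall k, jointly_measurable (entry X k)) ->
  jointly_measurable (fun t w => (M (alpha t w) *m X t w) j 0).
Proof.
move=> malpha rc mX.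
have := jointly_measurable_sum (index_enum 'I_n)
  (fun k => jointly_measurableM
     (jointly_measurable_regime (fun i => M i j k) malpha rc) (mX k)).
by apply: eq_measurable_fun => z _; rewrite mxE.
Qed.

End JointMeasurabilityAlgebra.

(** * The conditional law given the initial regime *)

Section StartLaw.
Context {d : measure_display} {Omega : measurableType d} {R : realType}.
Variables (P : probability Omega R) (L : nat) (N : @noise d Omega R L) (i : 'I_L).
Local Notation E := (regime N 0%R @^-1` [set i]).
Hypothesis PE : (0 < P E)%E.

(** [mnormalize] falls back on [P] when the mass to normalize is zero or infinite; [PE] and
    finiteness of [P] exclude both. *)
Lemma start_lawE A : start_law P N i A = (P (A `&` E) * (fine (P E))^-1%:E)%E.
Proof.
have ET : mrestr P (regime_measurable N 0 i) setT = P E by rewrite /mrestr setTI.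
rewrite /start_law /= /mnormalize.
rewrite [X in (X == 0%E)]ET [X in (X == +oo%E)]ET [X in fine X]ET ifF; first by [].
apply/negbTE; rewrite negb_or gt_eqF//= lt_eqF//.
by rewrite (le_lt_trans (probability_le1 P _))// ?ltry//; exact: regime_measurable.
Qed.

Lemma start_law_setI A : start_law P N i A = start_law P N i (A `&` E).
Proof. by rewrite !start_lawE -setIA setIid. Qed.

(** Since the normalizing factor is nonzero, the trace on [E] of a set that is null for the
    conditional law is [P]-null, and completeness of [P] applies to it. *)
Lemma start_law_complete A : measure_is_complete P ->
  (start_law P N i).-negligible A -> measurable (A `&` E).
Proof.
move=> hP [B [mB B0 AB]]; apply: hP; exists (B `&` E); split.
- by apply: measurableI => //; exact: regime_measurable.
- have Efin : P E \is a fin_num by apply: fin_num_measure; exact: regime_measurable.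
  move/eqP: B0; rewrite start_lawE mule_eq0 => /orP[/eqP//|].
  rewrite eqe invr_eq0 fine_eq0// => /eqP E0.
  by move: PE; rewrite E0 ltxx.
- exact: setSI.
Qed.

End StartLaw.

(** * Ito integrals of exponentially weighted integrands *)

Lemma within_continuous_sum {R : realType} (I : Type) (s : seq I) (A : set R)
    (f : I -> R -> R) : (forall i, {within A, continuous (f i)}) ->
  {within A, continuous (fun t => \sum_(i <- s) f i t)}.
Proof.
move=> fc; elim: s => [|i s IH].
  rewrite (_ : (fun _ => _) = fun=> 0); last by apply/funext => t; rewrite big_nil.
  by apply: continuous_subspaceT => t; exact: cvg_cst.
rewrite (_ : (fun _ => _) = fun t => f i t + \sum_(j <- s) f j t); last first.
  by apply/funext => t; rewrite big_cons.
apply/subspace_continuousP => x Ax; apply: cvgD.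
  by have /subspace_continuousP := fc i; exact.
by move/subspace_continuousP : IH; exact.
Qed.

Section ExpWeightIto.
Context {d : measure_display} {Omega : measurableType d} {R : realType}.
Local Notation mu := (@lebesgue_measure R).
Variables (F : R -> set (set Omega)) (Q : probability Omega R).
Variables (W : R -> Omega -> R) (c : R).
Hypothesis F_mono : forall s t, 0 <= s -> s <= t -> F s `<=` F t.
Hypothesis F_measurable : forall t, 0 <= t -> F t `<=` measurable.
Hypothesis W_cont : continuous_paths W.
Hypothesis W_measurable : forall t, 0 <= t -> measurable_fun setT (W t).
Implicit Types (H : simple_process F).

Lemma progressive_exp_scale phi : progressive F phi ->
  progressive F (fun t w => expR (c * t) * phi t w).
Proof.
move=> mphi t t0; apply: measurable_funM; last exact: mphi.
apply: measurable_funTS.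
by apply: (measurableT_comp (measurable_exp_scale c)); exact: measurable_fst.
Qed.

Lemma measurable_sp_coef H k : measurable_fun setT (sp_coef H k).
Proof.
move=> _ B mB; have := @sp_coef_measurable _ _ _ _ H k measurableT B mB.
rewrite !setTI.
have sub : <<s F (sp_time H k) >> `<=` d.-measurable.
  apply: smallest_sub; first exact: sigma_algebra_measurable.
  by apply: F_measurable; exact: sp_time_nonneg.
exact: sub.
Qed.

Lemma measurable_sp_int H t : 0 <= t -> measurable_fun setT (sp_int W H t).
Proof.
move=> t0; apply: measurable_sum => k; apply: measurable_funM.
  exact: measurable_sp_coef.
by apply: measurable_funB; apply: W_measurable; rewrite le_min t0 sp_time_nonneg.
Qed.

Lemma continuous_sp_int H : continuous_paths (sp_int W H).
Proof.
move=> w; apply: within_continuous_sum => k.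
apply/subspace_continuousP => x x0; apply: cvgM; first exact: cvg_cst.
apply: cvgB.
  by have /subspace_continuousP := within_ray_min (sp_time_nonneg H k.+1) (@W_cont w); exact.
by have /subspace_continuousP := within_ray_min (sp_time_nonneg H k) (@W_cont w); exact.
Qed.

Lemma jointly_measurable_sp_val H : jointly_measurable (sp_val H).
Proof.
apply: jointly_measurable_sum => k; apply: jointly_measurableM.
  by apply: jointly_measurable_omega; exact: measurable_sp_coef.
apply: jointly_measurable_time.
rewrite (_ : (fun _ => _) = \1_(`]sp_time H k, sp_time H k.+1]%classic)).
  exact: measurable_indic.
by apply/funext => t; rewrite indicE; congr (_%:R); rewrite mem_setE in_itv.
Qed.

Lemma sp_coef_uniform_bound H (n : nat) :
  exists2 M, 0 <= M & forall j w, (j < n)%N -> `|sp_coef H j w| <= M.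
Proof.
elim: n => [|n [M M0 HM]]; first by exists 0.
have [M' HM'] := sp_coef_bounded H n.
exists (Num.max M M'); first by rewrite le_max M0.
move=> j w; rewrite ltnS leq_eqVlt => /predU1P[->|jn].
  by rewrite le_max HM' orbT.
by rewrite le_max HM.
Qed.

(** Refine [H] finely enough that both error bounds of the refinement fall below [eta]; [B] is the
    event where the modulus of continuity of [W] is too large. *)
Lemma exp_conv_sp_approx H (eta : R) : 0 < eta ->
  exists H' : simple_process F,
    (forall t w, `|sp_val H' t w - expR (c * t) * sp_val H t w| <= eta) /\
    exists B, [/\ measurable B, (Q B < eta%:E)%E &
      forall w, ~ B w -> forall t, 0 <= t ->
        `|sp_int W H' t w - exp_conv c (sp_int W H ^~ w) t| <= eta].
Proof.
move=> eta0; have [M M0 HM] := sp_coef_uniform_bound H (sp_size H).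
pose T := sp_time H (sp_size H).
have T0 : 0 <= T by exact: sp_time_nonneg.
pose C := `|c| * expR (`|c| * T).
have C0 : 0 <= C by rewrite mulr_ge0 ?expR_ge0.
have MCT0 : 0 <= M * C * T by rewrite !mulr_ge0.
(* Chosen so that the bound M eta1 C T of [sp_int_refine] is at most [eta]; the added 1 keeps the
   denominator positive. *)
pose eta1 := eta / (M * C * T + 1).
have eta10 : 0 < eta1 by rewrite divr_gt0// ltr_wpDl.
have [K1 [B [mB QB osc]]] := modulus_in_probability Q T eta10 eta0 W_cont W_measurable.
pose n : R := (sp_size H)%:R.
(* [K > x1] brings the mesh T/K below 1/(K1+1), and [K > x2] brings the bound of [sp_val_refine]
   below [eta]. *)
pose x1 := T * K1.+1%:R; pose x2 := n * (M * (C * T)) / eta.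
have x10 : 0 <= x1 by rewrite mulr_ge0.
have x20 : 0 <= x2 by rewrite divr_ge0 ?(ltW eta0)// !mulr_ge0 ?ler0n.
pose K := (Num.bound x1 + Num.bound x2).+1.
have K0 : (0 < K)%N by [].
have KR0 : 0 < K%:R :> R by [].
have Kx1 : x1 < K%:R.
  by rewrite (lt_le_trans (archi_boundP x10))// ler_nat ltnW// ltnS leq_addr.
have Kx2 : x2 < K%:R.
  by rewrite (lt_le_trans (archi_boundP x20))// ler_nat ltnW// ltnS leq_addl.
exists (refine F_mono c H K0); split => [t w|].
  apply: (le_trans (sp_val_refine F_mono c K0 t (w:=w) T0 M0 (lexx _) _)).
    by move=> j jn; exact: HM.
  rewrite -/C -/n (_ : n * _ = n * (M * (C * T)) / K%:R); last by ring.
  by rewrite ler_pdivrMr// [leRHS]mulrC -ler_pdivrMr// ltW.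
exists B; split => // w nBw t t0.
apply: (le_trans (sp_int_refine F_mono c K0 (T:=T) (eta:=eta1) (M:=M) t0 _ T0 M0 (lexx _) _ (@W_cont w) _)).
- exact: ltW.
- by move=> j jn; exact: HM.
- move=> u v u0 uv vT uvK; apply: osc nBw _ _ u0 uv vT _.
  by rewrite (le_lt_trans uvK)// ltr_pdivrMr// mulrC ltr_pdivlMr.
rewrite -/C (_ : M * _ * T = (M * C * T) * eta / (M * C * T + 1)); last by rewrite /eta1; ring.
rewrite ler_pdivrMr ?ltr_wpDl// mulrDr mulr1 mulrC lerDl ltW//.
Qed.

Lemma cvge0_le_harmonic (u v : nat -> \bar R) :
  (forall k, 0 <= u k)%E -> v @ \oo --> 0%E ->
  (\forall k \near \oo, (u k <= v k + (k.+1%:R^-1)%:E)%E) -> u @ \oo --> 0%E.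
Proof.
move=> u0 v0 uv.
have vh : (fun k => v k + (k.+1%:R^-1)%:E)%E @ \oo --> 0%E.
  rewrite -[X in _ --> X]adde0; apply: cvgeD => //.
  by apply: cvg_EFin; [exact: nearW|exact: cvg_harmonic].
apply: (@squeeze_cvge _ _ _ _ (cst 0%E) u _ _ _ (cvg_cst _) vh).
by apply: filterS uv => k uvk; rewrite u0.
Qed.

End ExpWeightIto.

(** * Passage to the limit from simple integrals *)

Section ItoExpConv.
Context {d : measure_display} {Omega : measurableType d} {R : realType}.
Local Notation mu := (@lebesgue_measure R).
Variables (F : R -> set (set Omega)) (Q : probability Omega R).
Variables (W : R -> Omega -> R) (c : R) (D : set Omega).
Hypothesis F_mono : forall s t, 0 <= s -> s <= t -> F s `<=` F t.
Hypothesis F_measurable : forall t, 0 <= t -> F t `<=` measurable.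
Hypothesis W_cont : continuous_paths W.
Hypothesis W_measurable : forall t, 0 <= t -> measurable_fun setT (W t).
Hypothesis D_measurable : measurable D.
(* For Q = P( . | alpha_0 = i) and D = {alpha_0 = i}, completeness of P makes
   the events below measurable only inside D. *)
Hypothesis QD : forall A, Q A = Q (A `&` D).

Lemma measurable_integral_sqr (f : R -> Omega -> R) T (e : \bar R) :
  jointly_measurable f ->
  measurable [set w | (e < \int[mu]_(t in `[0%R, T]) (f t w ^+ 2)%:E)%E].
Proof.
move=> mf.
have mI : measurable_fun setT
    (fun w => \int[mu]_(t in `[0%R, T]) (f t w ^+ 2)%:E)%E.
  apply: (@measurable_ge0_integral_itv _ _ _ (fun t w => (f t w ^+ 2)%:E)).
    by move=> s w; rewrite lee_fin sqr_ge0.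
  apply/measurable_EFinP; apply: measurable_funX.
  exact: jointly_measurable_itv.
by rewrite -[X in measurable X]setTI; exact: emeasurable_fun_o_infty.
Qed.

Lemma ge0_integral_sqr_le (f g : R -> R) T a b :
  0 <= T -> 0 <= a -> 0 <= b ->
  measurable_fun `[(0 : R), T] f -> measurable_fun `[(0 : R), T] g ->
  (forall t, 0 <= t <= T -> f t ^+ 2 <= a + b * g t ^+ 2) ->
  (\int[mu]_(t in `[0%R, T]) (f t ^+ 2)%:E <=
   (a * T)%:E + b%:E * \int[mu]_(t in `[0%R, T]) (g t ^+ 2)%:E)%E.
Proof.
move=> T0 a0 b0 mf mg fg.
have mD : measurable (`[(0 : R), T]%classic : set R) by exact: measurable_itv.
have mf2 : measurable_fun `[(0 : R), T] (fun t => (f t ^+ 2)%:E).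
  by apply/measurable_EFinP; exact: measurable_funX.
have mg2 : measurable_fun `[(0 : R), T] (fun t => (g t ^+ 2)%:E).
  by apply/measurable_EFinP; exact: measurable_funX.
have lT : mu `[0%R, T]%classic = T%:E.
  rewrite lebesgue_measure_itv/= lte_fin.
  by move: T0; rewrite le_eqVlt => /predU1P[<-|->]; rewrite ?ltxx// sube0.
have -> : ((a * T)%:E = \int[mu]_(t in `[0%R, T]) a%:E)%E.
  by rewrite integral_cst// EFinM; congr (_ * _)%E; exact: esym lT.
rewrite -ge0_integralZl//; last by move=> t _; rewrite lee_fin sqr_ge0.
rewrite -ge0_integralD//.
- apply: ge0_le_integral => //.
  + by move=> t _; rewrite lee_fin sqr_ge0.
  + by apply: emeasurable_funD => //; exact: measurable_funeM.
- by move=> t _; rewrite mule_ge0// lee_fin sqr_ge0.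
- exact: measurable_funeM.
Qed.

(** The approximants are given by [exp_conv_sp_approx] for [H k] with tolerance 1/(k+1). For large
    [k], their error events lie in those of [H k] with smaller thresholds, up to an event of
    probability below 1/(k+1). *)
Lemma ito_exp_conv phi I : ito_integral F Q W phi I ->
  (forall t, 0 <= t -> measurable_fun D (I t)) ->
  (forall t, 0 <= t -> measurable_fun D (fun w => exp_conv c (I ^~ w) t)) ->
  ito_integral F Q W (fun t w => expR (c * t) * phi t w)
    (fun t w => exp_conv c (I ^~ w) t).
Proof.
move=> [pphi sqi Ic [H Happ]] mI mI'.
have mphi := progressive_jointly_measurable F_measurable pphi.
have mephi : jointly_measurable (fun t w => expR (c * t) * phi t w).
  apply: jointly_measurableM => //; apply: jointly_measurable_time.
  exact: measurable_exp_scale.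
have Ic' : continuous_paths (fun t w => exp_conv c (I ^~ w) t).
  by move=> w; apply: continuous_exp_conv; exact: Ic.
split => //.
- exact: progressive_exp_scale.
- apply: filterS sqi => w sqw T T0.
  pose C := expR (`|c| * T).
  apply: (@le_lt_trans _ _ ((0 * T)%:E +
      (C ^+ 2)%:E * \int[mu]_(t in `[0%R, T]) (phi t w ^+ 2)%:E)%E); last first.
    by rewrite mul0r add0e lte_mul_pinfty ?lee_fin ?sqr_ge0// sqw.
  apply: ge0_integral_sqr_le => //.
  + exact: sqr_ge0.
  + apply: measurable_funS (jointly_measurable_path w mephi).
      exact: measurable_itv.
    by move=> t /=; rewrite !in_itv/= => /andP[->].
  + apply: measurable_funS (jointly_measurable_path w mphi).
      exact: measurable_itv.
    by move=> t /=; rewrite !in_itv/= => /andP[->].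
  + move=> t tT; rewrite add0r exprMn ler_wpM2r ?sqr_ge0//.
    by rewrite lerXn2r ?nnegrE ?expR_ge0// exp_scale_le.
have eta0 k : 0 < k.+1%:R^-1 :> R by rewrite invr_gt0.
pose H' k := projT1 (cid (exp_conv_sp_approx Q c F_mono W_cont W_measurable (H k) (eta0 k))).
have H'P k := projT2 (cid (exp_conv_sp_approx Q c F_mono W_cont W_measurable (H k) (eta0 k))).
have ci (K : simple_process F) : continuous_paths (sp_int W K).
  exact: continuous_sp_int.
exists H' => T e T0 e0.
pose E := expR (`|c| * T).
have E0 : 0 < E by exact: expR_gt0.
split.
(* From (x + y)^2 <= 2 x^2 + 2 y^2, the new error is at most 2 T/(k+1)^2 plus 2 E^2 times the old
   one. With this [e'] the second term is at most e/2. *)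
- pose e' := e / (4 * E ^+ 2).
  have e'0 : 0 < e' by rewrite divr_gt0// mulr_gt0// exprn_gt0.
  have [Happ1 _] := Happ T e' T0 e'0.
  apply: cvge0_le_harmonic Happ1 _ => [k|]; first exact: measure_ge0.
  (* For k this large, T/(k+1)^2 <= e/4, so the first term is at most e/2; T + 1 replaces [T] to
     allow [T = 0]. *)
  have e4T : 0 < e / (4 * (T + 1)) by rewrite divr_gt0// mulr_gt0// ltr_wpDl.
  have := near_infty_natSinv_lt (PosNum e4T); apply: filterS => k /= ke.
  apply: (@le_trans _ _ (Q [set w | (e'%:E < \int[mu]_(t in `[0%R, T])
      ((sp_val (H k) t w - phi t w) ^+ 2)%:E)%E])); last first.
    by rewrite leeDl// lee_fin ltW.
  have mneg (f : R -> Omega -> R) : jointly_measurable f ->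
      jointly_measurable (fun t w => - f t w).
    by move=> mf; apply: measurableT_comp.
  apply: le_measure; rewrite ?inE.
  + apply: (measurable_integral_sqr (f := fun t w => _)).
    apply: jointly_measurableD; last exact: mneg.
    exact: jointly_measurable_sp_val.
  + apply: (measurable_integral_sqr (f := fun t w => _)).
    apply: jointly_measurableD; last exact: mneg.
    exact: jointly_measurable_sp_val.
  move=> w /=; apply: contraPP => /negP; rewrite -leNgt => le1.
  apply/negP; rewrite -leNgt.
  have mpath g : jointly_measurable g -> measurable_fun `[(0 : R), T] (g ^~ w).
    move=> mg; apply: measurable_funS (jointly_measurable_path w mg).
      exact: measurable_itv.
    by move=> t /=; rewrite !in_itv/= => /andP[->].
  have a0 : 0 <= 2 * k.+1%:R^-1 ^+ 2 :> R by rewrite mulr_ge0// sqr_ge0.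
  have b0 : 0 <= 2 * E ^+ 2 by rewrite mulr_ge0// sqr_ge0.
  have le2 := @ge0_integral_sqr_le (fun t => sp_val (H' k) t w - expR (c * t) * phi t w)
    (fun t => sp_val (H k) t w - phi t w) T (2 * k.+1%:R^-1 ^+ 2) (2 * E ^+ 2) T0 a0 b0.
  apply: le_trans (le2 _ _ _) _.
  + apply: (mpath (fun t w => _)); apply: jointly_measurableD; last exact: mneg.
    exact: jointly_measurable_sp_val.
  + apply: (mpath (fun t w => _)); apply: jointly_measurableD; last exact: mneg.
    exact: jointly_measurable_sp_val.
  + move=> t tT.
    have [/(_ t w) H'1 _] := H'P k.
    rewrite (_ : _ - _ = (sp_val (H' k) t w - expR (c * t) * sp_val (H k) t w) +
      expR (c * t) * (sp_val (H k) t w - phi t w)); last by ring.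
    have sqD (x y : R) : (x + y) ^+ 2 <= 2 * x ^+ 2 + 2 * y ^+ 2.
      by rewrite -subr_ge0 (_ : _ - _ = (x - y) ^+ 2) ?sqr_ge0//; ring.
    apply: (le_trans (sqD _ _)); rewrite lerD//.
      by rewrite ler_wpM2l// -real_normK ?num_real// lerXn2r ?nnegrE//.
    rewrite -mulrA ler_wpM2l// exprMn ler_wpM2r ?sqr_ge0//.
    by rewrite lerXn2r ?nnegrE ?expR_ge0// exp_scale_le.
  have -> : e = 2 * k.+1%:R^-1 ^+ 2 * T + (e - 2 * k.+1%:R^-1 ^+ 2 * T) by rewrite addrC subrK.
  rewrite EFinD leeD2l//.
  apply: (@le_trans _ _ ((2 * E ^+ 2)%:E * e'%:E)%E).
    by rewrite lee_wpmul2l// lee_fin mulr_ge0// sqr_ge0.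
  rewrite -EFinM lee_fin (_ : _ * e' = e / 2); last first.
    by rewrite /e'; field; rewrite gt_eqF.
  have k1 : k.+1%:R^-1 <= 1 :> R by rewrite invf_le1// ler1n.
  have hk : k.+1%:R^-1 ^+ 2 * T <= e / 4.
    apply: (@le_trans _ _ (k.+1%:R^-1 * (T + 1))).
      rewrite expr2 -mulrA ler_wpM2l ?(ltW (eta0 k))//.
      apply: (@le_trans _ _ (1 * T)); first by rewrite ler_wpM2r.
      by rewrite mul1r lerDl.
    have -> : e / 4 = e / (4 * (T + 1)) * (T + 1).
      by field; rewrite gt_eqF// ltr_wpDl.
    by rewrite ler_wpM2r ?addr_ge0//; exact: ltW.
  move: hk; rewrite -[2 * _ * T]mulrA; move: (_ ^+ 2 * T) => z; lra.
(* [Cst] is the Lipschitz constant of [exp_conv_dist]. Half of [e] goes to the transform of the old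
   error, half to the refinement error 1/(k+1). *)
- pose Cst := E * (1 + `|c| * T).
  have Cst0 : 0 < Cst.
    by rewrite mulr_gt0// ltr_pwDl// mulr_ge0.
  pose e2 := e / (2 * Cst).
  have e20 : 0 < e2 by rewrite divr_gt0// mulr_gt0.
  have e2E : e2 * Cst = e / 2.
    have half (x y : R) : 0 < y -> x / (2 * y) * y = x / 2.
      by move=> y0; field; rewrite gt_eqF.
    exact: half.
  have [_ Happ2] := Happ T e2 T0 e20.
  apply: cvge0_le_harmonic Happ2 _ => [k|]; first exact: measure_ge0.
  have e2' : 0 < e / 2 by rewrite divr_gt0.
  have := near_infty_natSinv_lt (PosNum e2'); apply: filterS => k /= ke.
  have [_ [B [mB QB H'2]]] := H'P k.
  have mex J (K : simple_process F) a :
      continuous_paths J -> (forall t, 0 <= t -> measurable_fun D (J t)) ->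
      measurable ([set w | exists t, 0 <= t <= T /\ a < `|sp_int W K t w - J t w|] `&` D).
    move=> Jc mJ; rewrite setIC.
    apply: (measurable_exists_gt (f := fun t w => sp_int W K t w - J t w)) => //.
      move=> w; apply/subspace_continuousP => x x0; apply: cvgB.
        by have /subspace_continuousP := ci K w; exact.
      by have /subspace_continuousP := Jc w; exact.
    move=> t t0; apply: measurable_funB; last exact: mJ.
    by apply: measurable_funTS; exact: measurable_sp_int.
  (* Both events are cut down to [D], where they are measurable, before monotonicity of [Q] is
     used. *)
  rewrite QD [X in (_ <= X + _)%E]QD.
  set G' := _ `&` D; set G := _ `&` D.
  have mG : measurable G by exact: mex.
  have mG' : measurable G' by exact: mex.
  apply: (@le_trans _ _ (Q (G `|` B))).
    apply: le_measure; rewrite ?inE//; first exact: measurableU.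
    move=> w [[t [tT lt1]] Dw].
    have [Bw|nBw] := pselect (B w); first by right.
    left; split => //; apply: contrapT => nG.
    (* The transform at [t] depends on the path over all of [[0, t]], so the old error is needed at
       every earlier time; [G] quantifies over these. *)
    have le1 s : 0 <= s <= t -> `|sp_int W (H k) s w - I s w| <= e2.
      move=> /andP[s0 st]; rewrite leNgt; apply/negP => lt2; apply: nG.
      by exists s; rewrite s0 (le_trans st)//; case/andP: tT.
    have /andP[t0 tT'] := tT.
    have h1 := H'2 w nBw t t0.
    have h2 := exp_conv_dist c t0 tT' (ltW e20) (ci (H k) w) (Ic w) le1.
    move: lt1; rewrite ltNge => /negP; apply.
    rewrite (le_trans (ler_distD (exp_conv c (sp_int W (H k) ^~ w) t) _ _))//.
    rewrite (splitr e) lerD//; first by rewrite (le_trans h1)// ltW.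
    by rewrite (le_trans h2)// -/E -/Cst e2E.
  by apply: le_trans (measureU2 _ _ _) _ => //; rewrite leeD2l// ltW.
Qed.

End ItoExpConv.

(** * The state equation under exponential weighting *)

Section ExpWeight.
Context {d : measure_display} {Omega : measurableType d} {R : realType}.
Implicit Types (c r : R).

Lemma exp_weightK c n : cancel (@exp_weight d Omega R c n) (@exp_weight d Omega R (- c) n).
Proof.
move=> X; apply/funext => t; apply/funext => w; rewrite /exp_weight scalerA.
by rewrite -expRD mulNr addNr expR0 scale1r.
Qed.

Lemma exp_weightNK c n : cancel (@exp_weight d Omega R (- c) n) (@exp_weight d Omega R c n).
Proof. by move=> X; have := exp_weightK (- c) X; rewrite opprK. Qed.

Lemma entry_exp_weight c n (X : @process d Omega R n) j :
  entry (exp_weight c X) j = fun t w => expR (c * t) * entry X j t w.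
Proof. by apply/funext => t; apply/funext => w; rewrite /entry !mxE. Qed.

Lemma innerZ n (a b : R) (v w : 'cV[R]_n) :
  inner (a *: v) (b *: w) = a * b * inner v w.
Proof. by rewrite /inner [(a *: v)^T]linearZ /= -scalemxAl -scalemxAr scalerA mxE. Qed.

(** Shifting is invertible, so the passage back from the shifted problem is an instance of the
    passage to it. *)
Lemma shifted_dataNK L n m r (D : @slq_data d Omega R L n m) :
  shifted_data (- r) (shifted_data r D) = D.
Proof.
case: D => A B C D Q S T b sigma q rho; rewrite /shifted_data /=.
rewrite !(mulNr r) !exp_weightK.
congr SLQData; apply/funext => i.
by rewrite raddfN opprK subrK.
Qed.

Lemma progressive_exp_weight (F : R -> set (set Omega)) c n
    (X : @process d Omega R n) :
  (forall j, progressive F (entry X j)) ->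
  forall j, progressive F (entry (exp_weight c X) j).
Proof. by move=> pX j; rewrite entry_exp_weight; exact: progressive_exp_scale. Qed.

Lemma jointly_measurable_exp_weight c n (X : @process d Omega R n) :
  (forall j, jointly_measurable (entry X j)) ->
  forall j, jointly_measurable (entry (exp_weight c X) j).
Proof.
move=> mX j; rewrite entry_exp_weight; apply: jointly_measurableM => //.
by apply: jointly_measurable_time; exact: measurable_exp_scale.
Qed.

(** Inside [D], the preimages under [f] and [g] differ only within the exceptional set, all of whose
    subsets are negligible and hence have measurable trace on [D]. *)
Lemma ae_eq_measurable_fun (Q : probability Omega R) (D : set Omega)
    (f g : Omega -> R) :
  measurable D -> (forall A, Q.-negligible A -> measurable (A `&` D)) ->
  measurable_fun setT g -> {ae Q, forall w, g w = f w} -> measurable_fun D f.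
Proof.
move=> mD hQ mg gf _ B mB.
have mN (A : set Omega) : measurable ((~` [set w | g w = f w] `&` A) `&` D).
  by apply: hQ; apply: negligibleS gf; exact: subIsetl.
have mgB : measurable (g @^-1` B) by rewrite -[X in measurable X]setTI; exact: mg.
rewrite (_ : D `&` f @^-1` B = ((D `&` g @^-1` B) `\` ((~` [set w | g w = f w] `&` setT) `&` D))
   `|` ((~` [set w | g w = f w] `&` f @^-1` B) `&` D)).
  by apply: measurableU; [apply: measurableD; [exact: measurableI|exact: mN]|exact: mN].
apply/seteqP; split => w /=.
  move=> [Dw Bw]; have [gfw|gfw] := pselect (g w = f w); last by right.
  by left; split; [split => //; rewrite gfw|move=> [[]]].
move=> [[[Dw Bw] nw]|[[_ Bw] Dw]]; split => //.
have [<-//|gfw] := pselect (g w = f w).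
by exfalso; apply: nw.
Qed.

End ExpWeight.

(** * The state equation of the shifted problem *)

Section StateShift.
Context {d : measure_display} {Omega : measurableType d} {R : realType}.
Local Notation mu := (@lebesgue_measure R).
Variables (P : probability Omega R) (L n m : nat) (N : @noise d Omega R L).
Local Notation F := (natural_filtration P N).
Local Notation Plaw := (start_law P N).
Hypothesis P_complete : measure_is_complete P.
Hypothesis bm_brownian : brownian_motion P F (bm N).
Hypothesis regime_markov : irreducible_markov_chain P (regime N).
Hypothesis regime0_gt0 : forall i : 'I_L, (0 < P (regime N 0%R @^-1` [set i]))%E.
Implicit Types (D : @slq_data d Omega R L n m) (r : R).

Lemma natural_filtration_mono s t : 0 <= s -> s <= t -> F s `<=` F t.
Proof.
move=> s0 st; apply: sub_sigma_algebra2 => A [[a [B [a0 As mB AE]]]|[a [i [a0 As AE]]]|A0].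
- by apply: Or31; exists a, B; split => //; exact: le_trans st.
- by apply: Or32; exists a, i; split => //; exact: le_trans st.
- exact: Or33.
Qed.

Lemma natural_filtration_measurable t : 0 <= t -> F t `<=` measurable.
Proof.
have [_ _ mW _] := bm_brownian.
move=> t0; apply: smallest_sub; first exact: sigma_algebra_measurable.
move=> A [[a [B [a0 As mB ->]]]|[a [i [a0 As ->]]]|[]//].
  by rewrite -[X in measurable X]setTI; exact: mW.
exact: regime_measurable.
Qed.

Let regime_rc := regime_markov.1.

Lemma progressive_process_jointly_measurable p (X : @process d Omega R p) :
  (forall j, progressive F (entry X j)) ->
  forall j, jointly_measurable (entry X j).
Proof.
move=> pX j; apply: progressive_jointly_measurable (pX j).
exact: natural_filtration_measurable.
Qed.

Lemma jointly_measurable_regime_mulmx p k (M : 'I_L -> 'M[R]_(k, p))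
    (X : @process d Omega R p) :
  (forall j, jointly_measurable (entry X j)) ->
  forall j, jointly_measurable (entry (fun t w => M (regime N t w) *m X t w) j).
Proof.
move=> mX j; apply: jointly_measurable_mulmx => //.
exact: regime_measurable.
Qed.

Lemma jointly_measurable_feedback (Theta : 'I_L -> 'M[R]_(m, n))
    (nu : @process d Omega R m) (X : @process d Omega R n) :
  (forall j, jointly_measurable (entry nu j)) ->
  (forall j, jointly_measurable (entry X j)) ->
  forall j, jointly_measurable (entry (feedback N Theta nu X) j).
Proof.
move=> mnu mX j.
have := jointly_measurableD (jointly_measurable_regime_mulmx Theta mX j) (mnu j).
by apply: eq_measurable_fun => z _; rewrite /entry/= /feedback [RHS]mxE.
Qed.

Lemma jointly_measurable_drift D (X : @process d Omega R n)
    (u : @process d Omega R m) :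
  (forall j, jointly_measurable (entry (fb D) j)) ->
  (forall j, jointly_measurable (entry u j)) ->
  (forall j, jointly_measurable (entry X j)) ->
  forall j, jointly_measurable (entry (drift N D X u) j).
Proof.
move=> mb mu_ mX j.
have := jointly_measurableD (jointly_measurableD
  (jointly_measurable_regime_mulmx (cA D) mX j)
  (jointly_measurable_regime_mulmx (cB D) mu_ j)) (mb j).
by apply: eq_measurable_fun => z _; rewrite /entry/= /drift [RHS]mxE [X in _ = X + _]mxE.
Qed.

(** The shift of [cA] by - r/2 is exactly the term that the product rule adds to the drift; the
    right-hand side is the integrand of [exp_conv_state] with c = - r/2. *)
Lemma entry_drift_shifted r D X u j :
  entry (drift N (shifted_data r D) (exp_weight (- (r / 2)) X)
    (exp_weight (- (r / 2)) u)) j =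
  fun t w => expR (- (r / 2) * t) *
    (entry (drift N D X u) j t w + - (r / 2) * entry X j t w).
Proof.
apply/funext => t; apply/funext => w; rewrite /entry.
transitivity ((expR (- (r / 2) * t) *:
  (drift N D X u t w + - (r / 2) *: X t w)) j 0); last first.
  by rewrite mxE [X in _ * X]mxE [X in _ + X]mxE.
congr (fun_of_matrix _ j 0); rewrite /drift /exp_weight /=.
rewrite mulmxBl mul_scalar_mx -!scalemxAr !scalerDr scaleNr.
by rewrite scalerN !scalerA (mulrC (r / 2)) (addrAC _ (- _)) (addrAC _ (- _)).
Qed.

Lemma entry_diffusion_shifted r D X u j :
  entry (diffusion N (shifted_data r D) (exp_weight (- (r / 2)) X)
    (exp_weight (- (r / 2)) u)) j =
  fun t w => expR (- (r / 2) * t) * entry (diffusion N D X u) j t w.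
Proof.
apply/funext => t; apply/funext => w; rewrite /entry /diffusion /exp_weight /=.
by rewrite -!scalemxAr -!scalerDr mxE.
Qed.

(** The product rule is applied path by path, and the stochastic term of the weighted state is the
    transform of the old one, which [ito_exp_conv] identifies as an Ito integral. *)
Lemma state_shift r D x i u X :
  (forall j, jointly_measurable (entry (fb D) j)) ->
  (forall j, jointly_measurable (entry u j)) ->
  state P N D x i u X ->
  state P N (shifted_data r D) x i (exp_weight (- (r / 2)) u)
    (exp_weight (- (r / 2)) X).
Proof.
move=> mb mu_ [pX cX dint [I [itoI XE]]].
set c := - (r / 2).
have [_ Wc mW _] := bm_brownian.
have mX := progressive_process_jointly_measurable pX.
have mdr := jointly_measurable_drift mb mu_ mX.
have mX' := jointly_measurable_exp_weight c mX.
have mdr' j : jointly_measurable (fun t w => expR (c * t) *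
    (entry (drift N D X u) j t w + c * entry X j t w)).
  apply: jointly_measurableM.
    by apply: jointly_measurable_time; exact: measurable_exp_scale.
  apply: jointly_measurableD; first exact: mdr.
  apply: (@jointly_measurableM _ _ _ (fun _ _ => c)); last exact: mX.
  by apply: jointly_measurable_time; exact: measurable_cst.
have Ic j w : {within `[0%R, +oo[, continuous (entry I j ^~ w)}.
  by have [_ _ /(_ w)] := itoI j.
(* Both the integrability of the drift and the state equation hold for all times off a null set, so
   [exp_conv_state] applies to almost every path. *)
have aeX j : {ae Plaw i, forall w, forall t, 0 <= t ->
    mu.-integrable `[0%R, t] (EFin \o (fun s => expR (c * s) *
      (entry (drift N D X u) j s w + c * entry X j s w))) /\
    expR (c * t) * entry X j t w = x j 0 +
      \int[mu]_(s in `[0%R, t]) (expR (c * s) *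
        (entry (drift N D X u) j s w + c * entry X j s w)) +
      exp_conv c (entry I j ^~ w) t}.
  apply: filterS2 (dint j) (XE j) => w dw Xw; exact: exp_conv_state.
have mD0 : measurable (regime N 0%R @^-1` [set i]) by exact: regime_measurable.
have neg A : (Plaw i).-negligible A -> measurable (A `&` regime N 0%R @^-1` [set i]).
  by apply: start_law_complete => //; exact: regime0_gt0.
split.
- exact: progressive_exp_weight.
- move=> j w; rewrite entry_exp_weight.
  by apply: within_continuous_expM; exact: cX.
- move=> j; apply: filterS (aeX j) => w Hw T T0.
  by rewrite entry_drift_shifted; have [] := Hw T T0.
exists (fun t w => \col_j exp_conv c (entry I j ^~ w) t).
have EI j : entry (fun t w => \col_j exp_conv c (entry I j ^~ w) t) j =
    fun t w => exp_conv c (entry I j ^~ w) t.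
  by apply/funext => t; apply/funext => w; rewrite /entry mxE.
split => j; last first.
  apply: filterS (aeX j) => w Hw t t0.
  rewrite EI entry_exp_weight entry_drift_shifted.
  by have [] := Hw t t0.
rewrite entry_diffusion_shifted EI.
apply: (@ito_exp_conv _ _ _ F (Plaw i) (bm N) c (regime N 0%R @^-1` [set i])) => //.
- exact: natural_filtration_mono.
- exact: natural_filtration_measurable.
- by move=> A; exact: start_law_setI.
(* Integrals are not assumed adapted, so their measurability is read off the
   state equation. *)
- move=> t t0.
  apply: (ae_eq_measurable_fun mD0 neg (g := fun w => entry X j t w - x j 0 -
     \int[mu]_(s in `[0%R, t]) entry (drift N D X u) j s w)).
    apply: measurable_funB; last exact: jointly_measurable_Rintegral.
    by apply: measurable_funB => //; exact: jointly_measurable_at.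
  by apply: filterS (XE j) => w /(_ t t0) ->; ring.
- move=> t t0.
  apply: (ae_eq_measurable_fun mD0 neg (g := fun w => entry (exp_weight c X) j t w - x j 0 -
     \int[mu]_(s in `[0%R, t]) (expR (c * s) *
        (entry (drift N D X u) j s w + c * entry X j s w)))).
    apply: measurable_funB; last exact: jointly_measurable_Rintegral (mdr' j).
    by apply: measurable_funB => //; exact: jointly_measurable_at.
  apply: filterS (aeX j) => w /(_ t t0)[_ H].
  by rewrite entry_exp_weight H; ring.
Qed.

End StateShift.

(** * Transfer of admissibility, cost and optimality *)

Section Equivalence.
Context {d : measure_display} {Omega : measurableType d} {R : realType}.
Variables (P : probability Omega R) (L n m : nat) (N : @noise d Omega R L).
Variables (r : R) (D : @slq_data d Omega R L n m).
Local Notation F := (natural_filtration P N).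
Local Notation Plaw := (start_law P N).
Hypothesis P_complete : measure_is_complete P.
Hypothesis bm_brownian : brownian_motion P F (bm N).
Hypothesis regime_markov : irreducible_markov_chain P (regime N).
Hypothesis regime0_gt0 : forall i : 'I_L, (0 < P (regime N 0%R @^-1` [set i]))%E.
Hypothesis fb_progressive : forall j, progressive F (entry (fb D) j).
Local Notation Dr := (shifted_data r D).
Local Notation down := (exp_weight (- (r / 2))).
Local Notation up := (exp_weight (r / 2)).

Let jm := progressive_process_jointly_measurable bm_brownian.

Lemma state_down x i (u : process m) (X : process n) :
  (forall j, jointly_measurable (entry u j)) ->
  state P N D x i u X -> state P N Dr x i (down u) (down X).
Proof. by move=> mu_; apply: state_shift => //; exact: jm. Qed.

(** This is [state_shift] for the data [Dr] and the discount [- r]. *)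
Lemma state_up x i (u : process m) (X : process n) :
  (forall j, jointly_measurable (entry u j)) ->
  state P N Dr x i u X -> state P N D x i (up u) (up X).
Proof.
move=> mu_ st; have := @state_shift _ _ _ P _ _ _ N P_complete bm_brownian
  regime_markov regime0_gt0 (- r) Dr x i u X.
rewrite shifted_dataNK mulNr opprK; apply => //.
by apply: jm => j; exact: progressive_exp_weight.
Qed.

(** Linearity of the feedback law is why [Theta] is common to both problems while [nu] gets
    weighted. *)
Lemma feedback_exp_weight (c : R) Theta (nu : process m) (X : process n) :
  exp_weight c (feedback N Theta nu X) =
  feedback N Theta (exp_weight c nu) (exp_weight c X).
Proof.
apply/funext => t; apply/funext => w.
by rewrite /exp_weight /feedback scalerDr -scalemxAr.
Qed.

(** Every term is bilinear in two weighted factors, [fq] and [frho] included, so e^(- r t / 2)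
    appears squared. *)
Lemma running_cost_shifted (X : process n) (u : process m) t w :
  running_cost N Dr (down X) (down u) t w =
  expR (- (r * t)) * running_cost N D X u t w.
Proof.
rewrite /running_cost /exp_weight /= -!scalemxAr !innerZ.
rewrite (_ : - (r * t) = - (r / 2) * t + - (r / 2) * t); last by field.
by rewrite expRD; ring.
Qed.

Lemma cost_shifted i (u : process m) (X : process n) :
  cost P N Dr i (down u) (down X) = disc_cost P N r D i u X.
Proof.
rewrite /cost /disc_cost; apply: eq_integral => w _; apply: eq_integral => t _.
by rewrite running_cost_shifted.
Qed.

Lemma admissible_down x i (u : process m) (X : process n) :
  disc_admissible P N r D x i u X -> admissible P N Dr x i (down u) (down X).
Proof.
move=> [st uL XL]; split; [|exact: uL|exact: XL]; apply: state_down st.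
(* Admissibility speaks only of the weighted control; undoing the weight recovers progressive
   measurability of [u]. *)
apply: jm => j; rewrite -(exp_weightNK (r / 2) u).
by apply: progressive_exp_weight; case: uL.
Qed.

Lemma admissible_up x i (u : process m) (X : process n) :
  admissible P N Dr x i u X -> disc_admissible P N r D x i (up u) (up X).
Proof.
move=> [st uL XL]; split; rewrite ?exp_weightK; [|exact: uL|exact: XL].
by apply: state_up st; apply: jm; case: uL.
Qed.

(** [up] and [down] are mutually inverse on admissible pairs and preserve cost, so each competitor
    in one problem is tested in the other. *)
Lemma open_loop_optimal_shift x i (u : process m) :
  open_loop_optimal P N Dr x i u <-> disc_open_loop_optimal P N r D x i (up u).
Proof.
split => [[X adm opt]|[X adm opt]].
  exists (up X); first exact: admissible_up.
  move=> v Y /admissible_down/opt; rewrite cost_shifted; apply: le_trans.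
  by rewrite -cost_shifted !exp_weightK.
exists (down X); first by rewrite -(exp_weightK (r / 2) u); exact: admissible_down.
move=> v Y /admissible_up/opt; rewrite -!cost_shifted !exp_weightK.
exact.
Qed.

Lemma closed_loop_strategy_shift Theta (nu : process m) :
  closed_loop_strategy P N Dr Theta nu <->
  disc_closed_loop_strategy P N r D Theta (up nu).
Proof.
split=> [[nuL st]|[]]; rewrite /disc_closed_loop_strategy exp_weightK.
  split; first exact: nuL.
  move=> x i; have [X stX XL] := st x i.
  exists (up X); last by rewrite exp_weightK.
  rewrite -feedback_exp_weight; apply: (state_up _ stX).
  apply: (jointly_measurable_feedback regime_markov); apply: jm.
    by case: nuL.
  by case: stX.
move=> nuL st; split; first exact: nuL.
move=> x i; have [X stX XL] := st x i.
exists (down X); last exact: XL.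
rewrite -[nu](exp_weightK (r / 2)) -feedback_exp_weight; apply: (state_down _ stX).
apply: (jointly_measurable_feedback regime_markov); apply: jm.
  by apply: progressive_exp_weight; case: nuL.
by case: stX.
Qed.

(** A closed-loop state of one problem is carried to the other, where its outcome is optimal by
    assumption; [open_loop_optimal_shift] brings this optimality back. *)
Lemma closed_loop_optimal_shift Theta (nu : process m) :
  closed_loop_optimal P N Dr Theta nu <->
  disc_closed_loop_optimal P N r D Theta (up nu).
Proof.
split=> [[st opt]|[st opt]].
  split; first exact: (closed_loop_strategy_shift Theta nu).1 st.
  move=> x i X stX.
  have pnu : forall j, progressive F (entry nu j) by case: st => -[].
  have mf j : jointly_measurable (entry (feedback N Theta (up nu) X) j).
    apply: (jointly_measurable_feedback regime_markov); apply: jm.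
      exact: progressive_exp_weight.
    by case: stX.
  have := state_down mf stX; rewrite feedback_exp_weight exp_weightK.
  move=> /opt/open_loop_optimal_shift.
  by rewrite feedback_exp_weight exp_weightNK.
have st' := (closed_loop_strategy_shift Theta nu).2 st.
split; first exact: st'.
move=> x i X stX; apply/open_loop_optimal_shift.
have pnu : forall j, progressive F (entry nu j) by case: st' => -[].
rewrite feedback_exp_weight; apply: opt; rewrite -feedback_exp_weight.
apply: (state_up _ stX).
apply: (jointly_measurable_feedback regime_markov); apply: jm => //.
by case: stX.
Qed.

End Equivalence.

Theorem theorem6p1 (R : realType) (d : measure_display)
    (Omega : measurableType d) (P : probability Omega R)
    (L n m : nat) (N : @noise d Omega R L) (D : @slq_data d Omega R L n m)
    (r : R)
    (hP : measure_is_complete P)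
    (hW : brownian_motion P (natural_filtration P N) (bm N))
    (halpha : irreducible_markov_chain P (regime N))
    (halpha0 : forall i : 'I_L, (0 < P (regime N 0%R @^-1` [set i]))%E)
    (hr : 0 < r)
    (hQ : forall i, (cQ D i)^T = cQ D i)
    (hR : forall i, (cR D i)^T = cR D i)
    (hb : L2F (natural_filtration P N) P (fb D))
    (hsigma : L2F (natural_filtration P N) P (fsigma D))
    (hq : L2F (natural_filtration P N) P (fq D))
    (hrho : L2F (natural_filtration P N) P (frho D)) :
  (forall (x : 'cV[R]_n) (i : 'I_L) (ur : process m),
     open_loop_optimal P N (shifted_data r D) x i ur <->
     disc_open_loop_optimal P N r D x i (exp_weight (r / 2) ur)) /\
  (forall (Theta : 'I_L -> 'M[R]_(m, n)) (nur : process m),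
     closed_loop_optimal P N (shifted_data r D) Theta nur <->
     disc_closed_loop_optimal P N r D Theta (exp_weight (r / 2) nur)).
Proof.
have fb_progressive := hb.1.
split => [x i ur|Theta nur].
  exact: open_loop_optimal_shift.
exact: closed_loop_optimal_shift.
Qed.
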